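(* Let $\mathcal H,\mathcal K$ be Hilbert spaces, let $A,B$ be positive definite bounded linear operators on $\mathcal H$ such that $0<m\le A,B\le M$ for scalars $m,M$, and let $\Phi:\mathcal B(\mathcal H)\to\mathcal B(\mathcal K)$ be a positive unital linear mapping. Then for $0\le t\le 1$, \[\Phi(A\natural_t B)\le \beta\,\Phi(A)\natural_t\Phi(B),\qquad \text{where}\quad \beta=\frac{(M+m)^{2t}\left(M^{1+t}+m^{1+t}\right)^4}{4^{2+t}M^{2+3t}m^{2+3t}}.\]
   Context: $\mathcal B(\mathcal H)$ is the algebra of bounded linear operators on $\mathcal H$. For real scalars, $m\le A\le M$ means $mI\le A\le MI$ in the usual order on self-adjoint operators ($A\ge B$ iff $A-B$ is positive semi-definite); ''$m\le A,B\le M$'' means this holds for both $A$ and $B$. A linear map $\Phi$ is positive if $A\ge 0$ implies $\Phi(A)\ge0$, and unital if $\Phi(I)=I$. For positive definite $A,B$, $A\sharp B=A^{1/2}(A^{-1/2}BA^{-1/2})^{1/2}A^{1/2}$, and for $0\le t\le1$ the weighted spectral geometric mean is $A\natural_t B=(A^{-1}\sharp B)^{t}A(A^{-1}\sharp B)^{t}$. *)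

(* Defs.v *)
From HB Require Import structures.
From mathcomp Require Import all_boot all_order all_algebra.
From mathcomp Require Import complex.
From mathcomp Require Import all_classical all_reals all_analysis.

Set Implicit Arguments.
Unset Strict Implicit.
Unset Printing Implicit Defensive.

Import Order.TTheory GRing.Theory Num.Theory Num.Def.
Import numFieldNormedType.Exports.

Local Open Scope classical_set_scope.
Local Open Scope ring_scope.
Local Open Scope complex_scope.

(* Complex Hilbert spaces. Following {dot _ for _}, the inner product is
   linear in its first argument. The norm takes values in R[i], where the
   order relation forces both sides of [0 <= z] to be real. *)
HB.mixin Record isHilbert (R : realType) (H : Type)
    of CompleteNormedModule R[i] H := {
  inner : {dot H for (@conjC R[i])} ;
  normE_inner : forall x : H, `|x| ^+ 2 = inner x x
}.

#[short(type="hilbertType")]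
HB.structure Definition Hilbert (R : realType) :=
  { H of isHilbert R H & CompleteNormedModule R[i] H }.

Section BoundedOperators.
Context {R : realType} (H : hilbertType R).

Definition bounded_linear : {pred (H -> H)} := fun f =>
  `[< linear f /\ exists c : R, forall x : H, `|f x| <= c%:C * `|x| >].

Record bounded_op := BoundedOp {
  bounded_op_fun :> H -> H ;
  bounded_op_fun_bounded : bounded_op_fun \in bounded_linear
}.

HB.instance Definition _ := [isSub for bounded_op_fun].
HB.instance Definition _ := [Choice of bounded_op by <:].

Lemma bounded_linear_submod_closed : submod_closed bounded_linear.
Proof.
split.
  apply/asboolP; split; first by move=> a x y /=; rewrite scaler0 addr0.
  by exists 0 => x /=; rewrite normr0 mul0r.
move=> a f g /asboolP[lf [c fc]] /asboolP[lg [d gd]].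
apply/asboolP; split.
  move=> k x y /=; rewrite !fctE lf lg !scalerDr !scalerA mulrC -!addrA.
  by congr (_ + _); rewrite addrCA.
exists ((complex.Re `|a|) * c + d) => x; rewrite !fctE.
have aE : (complex.Re `|a|)%:C = `|a|.
  exact/RRe_real/normr_real.
rewrite rmorphD rmorphM /= aE mulrDl -mulrA.
rewrite (le_trans (ler_normD _ _))// lerD// normrZ ler_wpM2l//.
Qed.

HB.instance Definition _ := GRing.isSubmodClosed.Build R[i] (H -> H)
  bounded_linear bounded_linear_submod_closed.
HB.instance Definition _ := [SubChoice_isSubLmodule of bounded_op by <:].

Lemma bounded_op_linear (A : bounded_op) : linear A.
Proof. by case: A => f /= /asboolP[]. Qed.

HB.instance Definition _ (A : bounded_op) :=
  GRing.isLinear.Build R[i] H H *:%R A (bounded_op_linear A).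

Lemma bounded_op_bounded (A : bounded_op) :
  exists c : R, forall x, `|A x| <= c%:C * `|x|.
Proof. by case: A => f /= /asboolP[]. Qed.

Lemma bounded_linear_id : idfun \in bounded_linear.
Proof. by apply/asboolP; split=> //; exists 1 => x /=; rewrite mul1r. Qed.

Lemma bounded_linear_comp (A B : bounded_op) : A \o B \in bounded_linear.
Proof.
apply/asboolP; split; first by move=> k x y /=; rewrite !linearP.
have [c Ac] := bounded_op_bounded A; have [d Bd] := bounded_op_bounded B.
exists (`|c| * d) => x /=; rewrite rmorphM /= -mulrA.
rewrite (le_trans (Ac _))// (@le_trans _ _ (`|c|%:C * `|B x|))//.
  by rewrite ler_wpM2r// lecR ler_norm.
by rewrite ler_wpM2l// lecR.
Qed.

Definition bounded_op_id := BoundedOp bounded_linear_id.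
Definition bounded_op_comp (A B : bounded_op) :=
  BoundedOp (bounded_linear_comp A B).

Lemma bounded_opP (A B : bounded_op) : (forall x, A x = B x) -> A = B.
Proof. by move=> AB; apply: val_inj; apply/funext. Qed.

Fact bounded_op_compA : associative bounded_op_comp.
Proof. by move=> A B C; apply: bounded_opP. Qed.
Fact bounded_op_id_comp : left_id bounded_op_id bounded_op_comp.
Proof. by move=> A; apply: bounded_opP. Qed.
Fact bounded_op_comp_id : right_id bounded_op_id bounded_op_comp.
Proof. by move=> A; apply: bounded_opP. Qed.
Fact bounded_op_compDl : left_distributive bounded_op_comp +%R.
Proof. by move=> A B C; apply: bounded_opP. Qed.
Fact bounded_op_compDr : right_distributive bounded_op_comp +%R.
Proof. by move=> A B C; apply: bounded_opP => x /=; rewrite linearD. Qed.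

HB.instance Definition _ := GRing.Zmodule_isPzRing.Build bounded_op
  bounded_op_compA bounded_op_id_comp bounded_op_comp_id
  bounded_op_compDl bounded_op_compDr.

End BoundedOperators.

Section Operators.
Context {R : realType} {H : hilbertType R}.
Implicit Types (A B X : bounded_op H) (p : {poly R}) (f : R -> R) (t : R).

Definition selfadjoint A := forall x y : H, inner (A x) y = inner x (A y).

Definition op_psd A := selfadjoint A /\ forall x : H, 0 <= inner (A x) x.

Definition op_le A B := op_psd (B - A).

Definition op_scalar (c : R) : bounded_op H := c%:C *: (1 : bounded_op H).

Definition op_inverse A X := X * A = 1 /\ A * X = 1.

Definition op_invertible A := exists X, op_inverse A X.

Definition op_inv A : bounded_op H := xget 0 [set X | op_inverse A X].

Definition op_posdef A := op_psd A /\ op_invertible A.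

Definition spectrum A : set R[i] :=
  [set z : R[i] | ~ op_invertible (A - z *: (1 : bounded_op H))].

Definition op_norm_le A (e : R) := forall x : H, `|A x| <= e%:C * `|x|.

Definition op_poly p A : bounded_op H :=
  \sum_(k < size p) (p`_k)%:C *: A ^+ k.

(* Continuous functional calculus of a self-adjoint operator: [X] is the limit
   in operator norm of [p(A)] as the real polynomials [p] tend to [f] uniformly
   on the spectrum of [A]. When [f] is continuous on the spectrum, such an [X]
   exists and is unique; the default value [0] of [op_fun] is then not used. *)
Definition is_op_fun f A X := forall e : R, 0 < e ->
  exists2 d : R, 0 < d &
    forall p, (forall x : R, spectrum A x%:C -> `|p.[x] - f x| <= d) ->
      op_norm_le (op_poly p A - X) e.

Definition op_fun f A : bounded_op H := xget 0 [set X | is_op_fun f A X].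

Definition op_powR A t : bounded_op H := op_fun (fun x => x `^ t) A.

Definition geometric_mean A B : bounded_op H :=
  op_powR A 2^-1 *
  op_powR (op_powR A (- 2^-1) * B * op_powR A (- 2^-1)) 2^-1 *
  op_powR A 2^-1.

Definition spectral_geometric_mean t A B : bounded_op H :=
  op_powR (geometric_mean (op_inv A) B) t * A *
  op_powR (geometric_mean (op_inv A) B) t.

End Operators.

Definition positive_map (R : realType) (H K : hilbertType R)
    (Phi : bounded_op H -> bounded_op K) :=
  forall A, op_psd A -> op_psd (Phi A).

Definition unital_map (R : realType) (H K : hilbertType R)
    (Phi : bounded_op H -> bounded_op K) := Phi 1 = 1.

(* Main.v *)
(* Write K(h) = (h + 1)^2 / (4h), h = M / m and G = A^-1 # B, so that G A G = B
   and A natural_t B = G^t A G^t; let L be the same mean for Phi(A), Phi(B).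
   Kantorovich's inequality Phi(A^-1) <= K(h) Phi(A)^-1 and the Ando inequality
   for the geometric mean give Phi(G) <= K(h)^(1/2) L. The same Ando inequality
   shows that the exponents s with Phi(G^s) <= K(h)^(s/2) L^s are stable under
   midpoints, so by continuity Phi(G^t) <= K(h)^(t/2) L^t. Next, the spectrum
   of A^(1/2) G^t A^(1/2) lies in some [m1, M1] with m1 M1 = m M and
   M1 / m1 = h^(1+t), whence G^t A G^t + m M A^-1 <= (m1 + M1) G^t. Applying Phi,
   using Phi(A)^-1 <= Phi(A^-1) and the bound on Phi(G^t), and eliminating
   Phi(A)^-1 by the arithmetic-geometric inequality gives the theorem with
   the constant K(h)^t K(h^(1+t)), which is at most beta = K(h)^t K(h^(1+t))^2.

   Ando's inequality for a merely positive Phi rests on Kadison's inequality,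
   obtained from Bernstein polynomials; these also yield the Weierstrass
   approximation needed for the functional calculus. Positivity of p(A) for p
   nonnegative on the spectrum follows by factoring p + l over the complex
   numbers. *)
Require Import Defs.
From mathcomp Require Import all_boot all_order all_algebra.
From mathcomp Require Import complex.
From mathcomp Require Import all_classical all_reals all_analysis.
From mathcomp Require Import ring lra.
Import Order.TTheory GRing.Theory Num.Theory.
Local Open Scope ring_scope.
Local Open Scope complex_scope.
Set Implicit Arguments.
Unset Strict Implicit.

(** * Real inner product and positive operators *)

Section ReImFacts.
Variable R : realType.
Implicit Types u v : R[i].

Lemma ReD u v : complex.Re (u + v) = complex.Re u + complex.Re v.
Proof. by case: u => ? ?; case: v. Qed.

Lemma ReN u : complex.Re (- u) = - complex.Re u.
Proof. by case: u. Qed.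

Lemma ReM u v :
  complex.Re (u * v) =
  complex.Re u * complex.Re v - complex.Im u * complex.Im v.
Proof. by case: u => ? ?; case: v. Qed.

End ReImFacts.

Section RealInner.
Variables (R : realType) (H : hilbertType R).
Implicit Types (x y z : H) (a b c : R) (A B T : bounded_op H).

(* Since [rp (i x) y] recovers the imaginary part of [inner x y], the real form
   [rp] suffices to express self-adjointness and positivity. *)
Definition rp x y : R := complex.Re (inner x y).
Definition sq x : R := rp x x.

Lemma rpDl x y z : rp (x + y) z = rp x z + rp y z.
Proof. by rewrite /rp linearDl ReD. Qed.

Lemma rpDr x y z : rp x (y + z) = rp x y + rp x z.
Proof. by rewrite /rp linearDr ReD. Qed.

Lemma rpNl x y : rp (- x) y = - rp x y.
Proof. by rewrite /rp linearNl ReN. Qed.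

Lemma rpNr x y : rp x (- y) = - rp x y.
Proof. by rewrite /rp linearNr ReN. Qed.

Lemma rpZl a x y : rp (a%:C *: x) y = a * rp x y.
Proof. by rewrite /rp linearZl_LR ReM /= mul0r subr0. Qed.

Lemma inner_conj x y : inner x y = Num.conj (inner y x).
Proof. by rewrite hermC expr0 mul1r. Qed.

Lemma rpC x y : rp x y = rp y x.
Proof.
apply: complexI; rewrite /rp !complexRe [in LHS]inner_conj.
by rewrite Re_conj.
Qed.

Lemma rpZr a x y : rp x (a%:C *: y) = a * rp x y.
Proof. by rewrite rpC rpZl rpC. Qed.

Lemma rp0l x : rp 0 x = 0. Proof. by rewrite /rp linear0l. Qed.

Lemma rp0r x : rp x 0 = 0. Proof. by rewrite rpC rp0l. Qed.

Lemma rp_i x y : rp ('i%C *: x) y = - complex.Im (inner x y).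
Proof. by rewrite /rp linearZl_LR ReM /= mul0r mul1r sub0r. Qed.

Lemma inner_eq_rp (u v x y : H) :
  inner u v = inner x y <->
  rp u v = rp x y /\ rp ('i%C *: u) v = rp ('i%C *: x) y.
Proof.
rewrite !rp_i /rp; split; first by move->.
case: (inner u v) => a b; case: (inner x y) => c d /= [-> /oppr_inj ->] //.
Qed.

Definition rpE := (rpDl, rpDr, rpNl, rpNr, rpZl, rpZr).

Lemma sqE x : (sq x)%:C = `|x| ^+ 2.
Proof. by rewrite normE_inner /sq /rp RRe_real// -normE_inner realX. Qed.

Lemma sq_ge0 x : 0 <= sq x.
Proof. by rewrite -lecR sqE exprn_ge0. Qed.

Lemma sq_eq0 x : sq x = 0 -> x = 0.
Proof.
move=> x0; apply/eqP; rewrite -normr_eq0 -sqrf_eq0 -sqE x0.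
exact/eqP.
Qed.

(** The norm is complex-valued; squaring moves its comparisons into [R]. *)
Lemma norm_le_sq (u v : H) (e : R) : 0 <= e ->
  (`|u| <= e%:C * `|v|) = (sq u <= e ^+ 2 * sq v).
Proof.
move=> e0; rewrite -[RHS]lecR rmorphM rmorphXn /= !sqE -exprMn.
by rewrite ler_sqr// nnegrE// mulr_ge0// ler0c.
Qed.

Lemma op_norm_leP T (e : R) : 0 <= e ->
  op_norm_le T e <-> forall x, sq (T x) <= e ^+ 2 * sq x.
Proof.
by move=> e0; split=> Te x; have := Te x; rewrite norm_le_sq.
Qed.

(** Expand [sq] at [e x + y] and at [e x - y]. With the weight [e] free to choose, this does the
    work of Cauchy-Schwarz below. *)
Lemma AMGM_rp (e : R) x y : 0 < e -> 2 * `|rp x y| <= e * sq x + e^-1 * sq y.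
Proof.
move=> e0; have s0 z : 0 <= e^-1 * sq z by rewrite mulr_ge0 ?sq_ge0// invr_ge0 ltW.
have := s0 (e%:C *: x + y); have := s0 (e%:C *: x - y).
rewrite /sq !rpE (rpC y x) => h1 h2.
have h3 : 0 <= e * rp x x - 2 * rp x y + e^-1 * rp y y.
  move: h1.
  rewrite (_ : e^-1 * _ = e * rp x x - 2 * rp x y + e^-1 * rp y y)//.
  by field; rewrite gt_eqF.
have h4 : 0 <= e * rp x x + 2 * rp x y + e^-1 * rp y y.
  move: h2.
  rewrite (_ : e^-1 * _ = e * rp x x + 2 * rp x y + e^-1 * rp y y)//.
  by field; rewrite gt_eqF.
by case: (ger0P (rp x y)) => h; lra.
Qed.

Lemma rp_bound (e : R) T x : 0 < e -> op_norm_le T e ->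
  `|rp (T x) x| <= e * sq x.
Proof.
move=> e0 /op_norm_leP -/(_ (ltW e0)) /(_ x) Te.
have e1 : 0 < e^-1 by rewrite invr_gt0.
have := @AMGM_rp e^-1 (T x) x e1; rewrite invrK => h.
have : e^-1 * sq (T x) <= e^-1 * (e ^+ 2 * sq x) by rewrite ler_wpM2l// ltW.
rewrite expr2 -!mulrA mulKf ?gt_eqF// => h'.
by lra.
Qed.

Lemma opM A B x : (A * B) x = A (B x). Proof. by []. Qed.
Lemma op1 x : (1 : bounded_op H) x = x. Proof. by []. Qed.
Lemma opD A B x : (A + B) x = A x + B x. Proof. by []. Qed.
Lemma opN A x : (- A) x = - A x. Proof. by []. Qed.
Lemma opZ (c : R[i]) A x : (c *: A) x = c *: A x. Proof. by []. Qed.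
Lemma op0 x : (0 : bounded_op H) x = 0. Proof. by []. Qed.

Definition opE := (opM, op1, opD, opN, opZ, op0).

Lemma op_scalerAl (c : R[i]) A B : c *: A * B = c *: (A * B).
Proof. exact: bounded_opP. Qed.

Lemma op_scalerAr (c : R[i]) A B : A * (c *: B) = c *: (A * B).
Proof. by apply: bounded_opP => x; rewrite !opE linearZ. Qed.

Lemma op_sq_bounded T : exists2 c : R, 0 < c & forall x, sq (T x) <= c * sq x.
Proof.
have [c hc] := bounded_op_bounded T.
exists (`|c| ^+ 2 + 1) => [|x]; first by rewrite ltr_wpDl// exprn_ge0.
have : `|T x| <= `|c|%:C * `|x|.
  by apply: le_trans (hc x) _; rewrite ler_wpM2r// lecR ler_norm.
by rewrite norm_le_sq// => h; apply: le_trans h _; rewrite ler_wpM2r ?sq_ge0// lerDl.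
Qed.

Definition sa T := forall x y, rp (T x) y = rp x (T y).

Lemma selfadjointP T : selfadjoint T <-> sa T.
Proof.
split=> hT x y; first by rewrite /rp hT.
by apply/inner_eq_rp; rewrite -linearZ !hT.
Qed.

Lemma op_psdP T : op_psd T <-> sa T /\ forall x, 0 <= rp (T x) x.
Proof.
split=> [[/selfadjointP hT pT]|[hT pT]].
  by split=> // x; have := pT x; rewrite lecE => /andP[_].
split; first exact/selfadjointP.
move=> x; rewrite lecE pT andbT /= eq_sym.
have /selfadjointP/(_ x x) := hT; rewrite inner_conj => /(congr1 (@complex.Im _)).
by case: (inner x (T x)) => u v /= vv; apply/eqP; lra.
Qed.

Lemma op_leP A B : op_le A B <->
  sa (B - A) /\ forall x, rp (A x) x <= rp (B x) x.
Proof.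
rewrite /op_le op_psdP; split=> -[h1 h2]; split=> // x.
  by have := h2 x; rewrite !opE rpDl rpNl subr_ge0.
by rewrite !opE rpDl rpNl subr_ge0.
Qed.

Lemma saD A B : sa A -> sa B -> sa (A + B).
Proof. by move=> hA hB x y; rewrite !opE !rpE hA hB. Qed.

Lemma saN A : sa A -> sa (- A).
Proof. by move=> hA x y; rewrite !opE !rpE hA. Qed.

Lemma saB A B : sa A -> sa B -> sa (A - B).
Proof. by move=> hA hB; apply/saD/saN. Qed.

Lemma saZ (c : R) A : sa A -> sa (c%:C *: A).
Proof. by move=> hA x y; rewrite !opE !rpE hA. Qed.

Lemma sa1 : sa 1. Proof. by []. Qed.

Lemma sa0 : sa 0. Proof. by move=> x y; rewrite !opE rp0l rp0r. Qed.

Lemma sa_conj A C : sa A -> sa C -> sa (C * A * C).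
Proof. by move=> hA hC x y; rewrite !opE hC hA hC. Qed.

Lemma saX A n : sa A -> sa (A ^+ n).
Proof.
move=> hA; elim: n => [|n IH]; first exact: sa1.
by move=> x y; rewrite {1}exprS exprSr !opE hA IH.
Qed.

Lemma sa_sum (I : Type) (r : seq I) (F : I -> bounded_op H) :
  (forall i, sa (F i)) -> sa (\sum_(i <- r) F i).
Proof.
move=> hF; elim/big_ind: _ => //; [exact: sa0|exact: saD].
Qed.

Lemma op_scalarE (c : R) x : op_scalar c x = c%:C *: x.
Proof. by []. Qed.

Lemma sa_scalar (c : R) : sa (op_scalar c).
Proof. exact/saZ/sa1. Qed.

(* [Nx] is controlled by the quadratic form of [N]: expand [0 <= <N y, y>] at
   [y = x - c^-1 N x]. *)
Lemma psd_sq_le (N : bounded_op H) (c : R) : sa N -> 0 < c ->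
  (forall x, 0 <= rp (N x) x) -> (forall x, rp (N x) x <= c * sq x) ->
  forall x, sq (N x) <= c * rp (N x) x.
Proof.
move=> hN c0 N0 Nc x.
have := N0 (x - (c^-1)%:C *: N x).
rewrite linearB linearZ /= !rpE (hN (N x) x) -!/(sq _).
have := Nc (N x); rewrite -(ler_pM2l (_ : 0 < c^-1 ^+ 2)) ?exprn_gt0 ?invr_gt0//.
rewrite [_ ^+ 2 * (c * _)]mulrA => h1 h2.
rewrite -(ler_pM2l (_ : 0 < c^-1)) ?invr_gt0// mulKf ?gt_eqF//.
have E : c^-1 ^+ 2 * c = c^-1 by rewrite expr2 mulfVK// gt_eqF.
rewrite E in h1; lra.
Qed.

(** A one-sided form of invertibility: it follows from the existence of an inverse and passes to
    products, so spectral arguments can use it without constructing inverses. *)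
Definition bounded_below T :=
  exists2 c : R, 0 < c & forall x, c * sq x <= sq (T x).

(* At the least [l >= 0] with [T <= l], the operator [l - T] is positive, and
   if it were bounded below then [T <= l - d] for some [d > 0]. *)
Lemma spectral_gap T : sa T ->
  (forall l : R, 0 < l -> bounded_below (op_scalar l - T)) ->
  forall x, rp (T x) x <= 0.
Proof.
move=> hT bbT.
pose S := [set l : R | 0 <= l /\ forall x, rp (T x) x <= l * sq x]%classic.
have [c c0 Tc] := op_sq_bounded T.
have TB x : 2 * `|rp (T x) x| <= (1 + c) * sq x.
  have := @AMGM_rp 1 (T x) x ltr01; rewrite invr1 => h.
  have := Tc x; lra.
have ST : S (1 + c).
  split=> [|x]; first lra.
  have := TB x; have := ler_norm (rp (T x) x); have := sq_ge0 x.
  have := normr_ge0 (rp (T x) x); lra.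
have S0 : lbound S 0 by move=> l [].
have Sinf : has_inf S by split; [exists (1 + c)|exists 0].
have infS0 : 0 <= inf S by apply: lb_le_inf => //; exists (1 + c).
have Tinf x : rp (T x) x <= inf S * sq x.
  apply/ler_addgt0Pr => e e0.
  have d0 : 0 < e / (1 + sq x) by rewrite divr_gt0// ltr_pwDl// sq_ge0.
  have [l [l0 Tl] lS] := inf_adherent d0 Sinf.
  apply: le_trans (Tl x) _.
  apply: (@le_trans _ _ ((inf S + e / (1 + sq x)) * sq x)).
    by rewrite ler_wpM2r ?sq_ge0// ltW.
  rewrite mulrDl lerD2l mulrAC ler_pdivrMr ?ltr_pwDl ?sq_ge0//.
  by rewrite ler_pM2l// lerDr.
have [i0|i0] := leP (inf S) 0.
  move=> x; apply: le_trans (Tinf x) _.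
  by rewrite mulr_le0_ge0 ?sq_ge0.
have [d d0 dT] := bbT _ i0.
pose N := op_scalar (inf S) - T.
have NE x : rp (N x) x = inf S * sq x - rp (T x) x.
  by rewrite !opE !rpE.
have k0 : 0 < inf S + (1 + c) by lra.
have hN := @psd_sq_le N _ (saB (sa_scalar _) hT) k0 _ _.
have {}hN x : sq (N x) <= (inf S + (1 + c)) * rp (N x) x.
  apply: hN => y; rewrite NE; first by rewrite subr_ge0.
  have := TB y; have := ler_norm (- rp (T y) y); rewrite normrN.
  have := sq_ge0 y; have := normr_ge0 (rp (T y) y); lra.
(* From [d * sq x <= sq (N x) <= (inf S + (1 + c)) * rp (N x) x], the upper bound of [T] drops by
   [f]. This contradicts the infimum if [f <= inf S], and makes the bound negative otherwise. *)
pose f := d / (inf S + (1 + c)).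
have f0 : 0 < f by rewrite divr_gt0.
have Tf x : rp (T x) x <= (inf S - f) * sq x.
  have := le_trans (dT x) (hN x).
  rewrite -ler_pdivrMl// mulrA -[_^-1 * d]mulrC -/f NE; lra.
have [fi|fi] := leP f (inf S).
  have : S (inf S - f) by split=> //; lra.
  by move/(ge_inf (ex_intro _ 0 S0)); lra.
move=> x; apply: le_trans (Tf x) _; rewrite mulr_le0_ge0 ?sq_ge0//; lra.
Qed.

End RealInner.

(** * Polynomials of an operator *)

Section PolynomialCalculus.
Variables (R : realType) (H : hilbertType R).
Implicit Types (x y : H) (a b c e : R) (A B T : bounded_op H).
Local Notation Id := (1 : bounded_op H).
Implicit Types (p : {poly R}) (q : {poly R[i]}).

(** Complex coefficients allow a splitting into linear factors; [op_poly] is the case of real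
    coefficients. *)
Definition cpoly q A : bounded_op H := \sum_(k < size q) q`_k *: A ^+ k.

Lemma cpoly_wide n q A : (size q <= n)%N ->
  cpoly q A = \sum_(k < n) q`_k *: A ^+ k.
Proof.
move=> qn; rewrite /cpoly -(subnKC qn) big_split_ord /= [X in _ = _ + X]big1 ?addr0//.
by move=> i _; rewrite nth_default ?leq_addr// scale0r.
Qed.

Lemma cpolyD q r A : cpoly (q + r) A = cpoly q A + cpoly r A.
Proof.
have qr := size_polyD q r.
rewrite (cpoly_wide A qr) (cpoly_wide A (leq_maxl (size q) (size r))).
rewrite (cpoly_wide A (leq_maxr (size q) (size r))) -big_split /=.
by apply: eq_bigr => k _; rewrite coefD scalerDl.
Qed.

Lemma cpolyZ (z : R[i]) q A : cpoly (z *: q) A = z *: cpoly q A.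
Proof.
rewrite (cpoly_wide A (size_scale_leq z q)) scaler_sumr.
by apply: eq_bigr => k _; rewrite coefZ scalerA.
Qed.

Lemma cpolyMX q A : cpoly (q * 'X) A = cpoly q A * A.
Proof.
rewrite (@cpoly_wide (size q).+1) ?size_polyMX_leq//; last first.
  by have [->|q0] := eqVneq q 0; rewrite ?mul0r ?size_poly0// size_mulX.
rewrite big_ord_recl coefMX eqxx scale0r add0r /cpoly mulr_suml.
by apply: eq_bigr => k _; rewrite lift0 coefMX /= exprSr op_scalerAl.
Qed.

Lemma cpolyC (z : R[i]) A : cpoly z%:P A = z *: Id.
Proof.
rewrite (@cpoly_wide 1) ?size_polyC; last by case: (z != 0).
by rewrite big_ord1 coefC eqxx expr0.
Qed.

Lemma cpoly0 A : cpoly 0 A = 0.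
Proof. by rewrite /cpoly size_poly0 big_ord0. Qed.

Lemma cpolyM q r A : cpoly (q * r) A = cpoly q A * cpoly r A.
Proof.
elim/poly_ind: r => [|r z IH].
  by rewrite mulr0 cpoly0 mulr0.
rewrite mulrDr mulrA !cpolyD !cpolyMX IH mulrDr mulrA; congr (_ + _).
by rewrite mulrC mul_polyC cpolyZ cpolyC op_scalerAr mulr1.
Qed.

Lemma op_poly_cpoly p A : op_poly p A = cpoly (map_poly (real_complex R) p) A.
Proof.
rewrite /op_poly /cpoly size_map_poly.
by apply: eq_bigr => k _; rewrite coef_map.
Qed.

Lemma op_polyD p r A : op_poly (p + r) A = op_poly p A + op_poly r A.
Proof. by rewrite !op_poly_cpoly rmorphD /= cpolyD. Qed.

Lemma op_polyM p r A : op_poly (p * r) A = op_poly p A * op_poly r A.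
Proof. by rewrite !op_poly_cpoly rmorphM /= cpolyM. Qed.

Lemma op_polyC c A : op_poly c%:P A = op_scalar c.
Proof. by rewrite !op_poly_cpoly map_polyC /= cpolyC. Qed.

Lemma op_polyZ c p A : op_poly (c *: p) A = c%:C *: op_poly p A.
Proof. by rewrite !op_poly_cpoly map_polyZ /= cpolyZ. Qed.

Lemma op_polyN p A : op_poly (- p) A = - op_poly p A.
Proof. by rewrite -scaleN1r op_polyZ rmorphN rmorph1 scaleN1r. Qed.

Lemma op_polyB p r A : op_poly (p - r) A = op_poly p A - op_poly r A.
Proof. by rewrite op_polyD op_polyN. Qed.

Lemma op_poly1 A : op_poly 1 A = 1.
Proof. by rewrite op_polyC /op_scalar scale1r. Qed.

Lemma op_polyX A : op_poly 'X A = A.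
Proof.
rewrite -['X]mul1r op_poly_cpoly rmorphM /= map_polyX cpolyMX.
by rewrite -op_poly_cpoly op_poly1 mul1r.
Qed.

Lemma sa_op_poly p A : sa A -> sa (op_poly p A).
Proof. by move=> hA; apply: sa_sum => k; apply/saZ/saX. Qed.

Lemma bounded_belowM A B :
  bounded_below A -> bounded_below B -> bounded_below (A * B).
Proof.
move=> [c c0 hc] [d d0 hd]; exists (c * d) => [|x]; first exact: mulr_gt0.
rewrite opM; apply: le_trans (hc _).
by rewrite -mulrA ler_wpM2l// ltW.
Qed.

Lemma sqZ (z : R[i]) x :
  sq (z *: x) = (complex.Re z ^+ 2 + complex.Im z ^+ 2) * sq x.
Proof.
by apply: complexI; rewrite rmorphM /= !sqE normrZ exprMn -add_Re2_Im2.
Qed.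

Lemma sqB x y : sq (x - y) = sq x - 2 * rp x y + sq y.
Proof. by rewrite /sq !rpE (rpC y x); ring. Qed.

Lemma bounded_belowZ (z : R[i]) A :
  z != 0 -> bounded_below A -> bounded_below (z *: A).
Proof.
move=> z0 [c c0 hc]; set n := complex.Re z ^+ 2 + complex.Im z ^+ 2.
have n0 : 0 < n.
  by rewrite -ltcR add_Re2_Im2 exprn_gt0// normr_gt0.
exists (n * c) => [|x]; first exact: mulr_gt0.
by rewrite opZ sqZ -mulrA ler_wpM2l// ltW.
Qed.

Lemma bounded_below1 : bounded_below (1 : bounded_op H).
Proof. by exists 1 => // x; rewrite mul1r. Qed.

Lemma bounded_belowN A : bounded_below A -> bounded_below (- A).
Proof. by move=> hA; rewrite -scaleN1r; apply: bounded_belowZ; rewrite // oppr_eq0 oner_eq0. Qed.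

(** Over the complex numbers [q] splits, so [cpoly q A] is a nonzero multiple of a product of
    factors [A - z] with [z] a root. *)
Lemma cpoly_bounded_below q A : q != 0 ->
  (forall z, root q z -> bounded_below (A - z *: Id)) -> bounded_below (cpoly q A).
Proof.
move=> q0 hq; have [r qE] := closed_field_poly_normal q.
rewrite qE cpolyZ; apply: bounded_belowZ; first by rewrite lead_coef_eq0.
have : forall z, z \in r -> bounded_below (A - z *: Id).
  move=> z zr; apply: hq; rewrite qE rootE hornerZ.
  have : root (\prod_(z <- r) ('X - z%:P)) z by rewrite root_prod_XsubC.
  by move/eqP->; rewrite mulr0.
elim: r {qE} => [|z r IH] hr.
  by rewrite big_nil cpolyC scale1r; exact: bounded_below1.
rewrite big_cons cpolyM; apply: bounded_belowM; last first.
  by apply: IH => w wr; apply: hr; rewrite inE wr orbT.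
rewrite cpolyD -[in cpoly 'X _](mul1r 'X) cpolyMX -polyCN !cpolyC scale1r mul1r scaleNr.
by apply: hr; rewrite inE eqxx.
Qed.

(** For [z = u + i v] and [B = A - u], the vectors [B x] and [i x] are orthogonal for [rp], so the
    square norm of [(A - z) x] is [sq (B x) + v ^+ 2 * sq x]. *)
Lemma bounded_below_im A (z : R[i]) : sa A -> complex.Im z != 0 ->
  bounded_below (A - z *: Id).
Proof.
case: z => u v hA /= v0; exists (v ^+ 2) => [|x].
  by rewrite exprn_even_gt0.
set B := A - op_scalar u; have hB : sa B by apply/saB/sa_scalar.
have -> : (A - (u +i* v)%C *: Id) x = B x - v%:C *: ('i%C *: x).
  rewrite !opE scalerA -addrA -opprD; congr (_ - _).
  by rewrite -scalerDl; congr (_ *: _); simpc.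
have i0 : rp (B x) ('i%C *: x) = 0.
  have e1 : rp (B x) ('i%C *: x) = - complex.Im (inner x (B x)).
    by rewrite rpC rp_i.
  have : rp (B x) ('i%C *: x) = - complex.Im (inner (B x) x).
    by rewrite hB linearZ /= rpC rp_i.
  rewrite e1 inner_conj; case: (inner (B x) x) => ? w /=; lra.
rewrite sqB rpZr i0 !sqZ /=; have := sq_ge0 (B x); lra.
Qed.

Lemma bounded_below_rp A c : 0 < c -> (forall x, c * sq x <= rp (A x) x) ->
  bounded_below A.
Proof.
move=> c0 hA; exists (c ^+ 2) => [|x]; first exact: exprn_gt0.
have := sq_ge0 (A x - c%:C *: x); rewrite sqB rpZr sqZ /=.
have := hA x; rewrite -(ler_pM2l c0); lra.
Qed.

Lemma op_invertible_bounded_below A : op_invertible A -> bounded_below A.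
Proof.
move=> [X [XA _]]; have [c c0 hc] := op_sq_bounded X.
exists c^-1 => [|x]; first by rewrite invr_gt0.
by rewrite ler_pdivrMl//; have := hc (A x); rewrite -opM XA.
Qed.

(* Spectral mapping: for [l > 0] the polynomial [p + l] has no root on which
   [A - z] could fail to be bounded below. *)
Lemma op_poly_ge0 p A : sa A ->
  (forall u : R, p.[u] < 0 -> bounded_below (A - op_scalar u)) ->
  forall x, 0 <= rp (op_poly p A x) x.
Proof.
move=> hA hp.
(* The factorisation of [p + l] needs a nonzero polynomial, which fails only for [p] the constant
   [- l]. Then [A - u] is bounded below at every real [u], so [A <= c] for every [c]; taking
   [c = - (1 + d)], with [d] from the bound on [A], forces every vector to vanish. *)
have [[l [l0 pl]]|npl] := pselect (exists l : R, 0 < l /\ p = (- l)%:P).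
  have bbA u : bounded_below (A - op_scalar u).
    by apply: hp; rewrite pl hornerC oppr_lt0.
  have key c x : rp (A x) x <= c * sq x.
    have := @spectral_gap _ _ (A - op_scalar c) (saB hA (sa_scalar _)) _ x.
    rewrite !opE !rpE -/(sq _) subr_le0; apply=> u u0.
    have -> : op_scalar u - (A - op_scalar c) = - (A - op_scalar (u + c)).
      rewrite /op_scalar rmorphD /= scalerDl !opprB addrA [in RHS]addrC -addrA.
      by rewrite [- A + _]addrC addrA.
    exact: bounded_belowN.
  move=> x; have [d d0 hd] := op_sq_bounded A.
  have := hd x; have := key (- (1 + d)) x.
  have := @AMGM_rp _ _ 1 (A x) x ltr01; rewrite invr1 !mul1r.
  have := ler_norm (- rp (A x) x); rewrite normrN => h1 h2 h3 h4.
  have : sq x = 0.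
    apply/le_anti; rewrite sq_ge0 andbT.
    rewrite -(ler_pM2l d0) mulr0; have := sq_ge0 x; lra.
  by move/sq_eq0->; rewrite rp0r.
move=> x; rewrite -oppr_le0 -rpNl -opN.
apply: (@spectral_gap _ _ (- op_poly p A)); first exact/saN/sa_op_poly.
move=> l l0; rewrite opprK -(op_polyC l A) -op_polyD op_poly_cpoly.
apply: cpoly_bounded_below.
  rewrite map_poly_eq0; apply/eqP => lp; apply: npl; exists l; split=> //.
  by rewrite polyCN; apply/eqP; rewrite -addr_eq0 addrC lp.
move=> z; have [z0|] := eqVneq (complex.Im z) 0; last first.
  by move=> /bounded_below_im h _; exact: h.
have -> : z = (complex.Re z)%:C by case: z z0 => ? ? /= ->.
rewrite fmorph_root rootE hornerD hornerC => /eqP lp.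
by apply: hp; lra.
Qed.

Lemma bounded_below_outside A a b u : sa A ->
  (forall x, a * sq x <= rp (A x) x) -> (forall x, rp (A x) x <= b * sq x) ->
  (u < a) || (b < u) -> bounded_below (A - op_scalar u).
Proof.
move=> hA aA Ab /orP[ua|bu].
  apply: (@bounded_below_rp _ (a - u)); first by rewrite subr_gt0.
  by move=> x; rewrite !opE !rpE; have := aA x; rewrite -/(sq _); lra.
rewrite -opprB; apply/bounded_belowN/(@bounded_below_rp _ (u - b)).
  by rewrite subr_gt0.
by move=> x; rewrite !opE !rpE; have := Ab x; rewrite -/(sq _); lra.
Qed.

(** The operator [e - A] lies between 0 and [2 * e], and [psd_sq_le] applied to it rearranges to the
    claim. *)
Lemma op_norm_le_sa A e : sa A -> 0 < e ->
  (forall x, `|rp (A x) x| <= e * sq x) -> op_norm_le A e.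
Proof.
move=> hA e0 hx; apply/(op_norm_leP _ (ltW e0)) => x.
have sN : sa (op_scalar e - A) by apply/saB/hA/sa_scalar.
have rN y : rp ((op_scalar e - A) y) y = e * sq y - rp (A y) y.
  by rewrite !opE !rpE.
have e2 : 0 < 2 * e by rewrite mulr_gt0.
have := @psd_sq_le _ _ _ _ sN e2 _ _ x.
rewrite rN !opE sqB sqZ rpZl /= (rpC x) => h.
suff : (e ^+ 2 + 0 ^+ 2) * sq x - 2 * (e * rp (A x) x) + sq (A x) <=
  2 * e * (e * sq x - rp (A x) x) by lra.
have [hl hr] : (forall y, rp (A y) y <= e * sq y) /\
    (forall y, - (e * sq y) <= rp (A y) y).
  by split=> y; have := hx y; rewrite ler_norml => /andP[].
apply: le_trans (h _ _) => [|y|y]; rewrite ?rN; last 2 first.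
- by have := hl y; lra.
- by have := hr y; lra.
lra.
Qed.

(** Apply [op_poly_ge0] to [e + p] and to [e - p]. *)
Lemma op_poly_norm_le p A e : sa A -> 0 < e ->
  (forall u : R, e < `|p.[u]| -> bounded_below (A - op_scalar u)) ->
  op_norm_le (op_poly p A) e.
Proof.
move=> hA e0 hp; apply: op_norm_le_sa => // [|x]; first exact: sa_op_poly.
rewrite ler_norml -subr_ge0 opprK -[X in _ && X]subr_ge0.
have E r : rp (op_poly (e%:P + r) A x) x = e * sq x + rp (op_poly r A x) x.
  by rewrite op_polyD op_polyC !opE !rpE.
rewrite [X in 0 <= X]addrC -E -rpNl -opN -op_polyN -E; apply/andP; split.
  apply: op_poly_ge0 => // u; rewrite hornerD hornerC => pu; apply: hp.
  by rewrite ltr_normr; apply/orP; right; lra.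
apply: op_poly_ge0 => // u; rewrite hornerD hornerN hornerC => pu; apply: hp.
by rewrite ltr_normr; apply/orP; left; lra.
Qed.

End PolynomialCalculus.

(** * Limits of operators *)

(** A fixed explicit rate of convergence, carried through the completeness arguments. *)
Definition harm (R : realType) (n : nat) : R := n.+1%:R^-1.

Section OperatorLimits.
Variables (R : realType) (H : hilbertType R).
Implicit Types (x y : H) (a b c e : R) (A B T X : bounded_op H).

Local Notation s := (harm R).

Lemma harmonic_gt0 n : 0 < s n. Proof. by rewrite invr_gt0. Qed.

Lemma harmonic_le n m : (n <= m)%N -> s m <= s n.
Proof. by move=> nm; rewrite lef_pV2 ?posrE// ler_nat. Qed.

Lemma harmonic_small c e : 0 <= c -> 0 < e -> exists n, s n * c < e.
Proof.
move=> c0 e0; exists (Num.truncn (c / e)).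
rewrite /harm ltr_pdivrMl// mulrC -ltr_pdivrMl// mulrC.
exact: truncnS_gt.
Qed.

Lemma complex_gt0E (z : R[i]) : 0 < z -> 0 < complex.Re z /\ z = (complex.Re z)%:C.
Proof. by case: z => u v; rewrite ltcE /= => /andP[/eqP -> ->]. Qed.

Lemma harmonic_cauchy_lim (u : nat -> H) c : 0 <= c ->
  (forall n m, `|u n - u m| <= ((s n + s m) * c)%:C) ->
  exists l, forall n, `|u n - l| <= (s n * c)%:C.
Proof.
move=> c0 hu.
have cu : cauchy (u @ \oo)%classic.
  apply: cauchy_exP => e /complex_gt0E[r0 er].
  have [N hN] := harmonic_small (mulr_ge0 (ler0n R 2) c0) r0.
  exists (u N); exists N => // n /= Nn; rewrite -ball_normE /=.
  apply: le_lt_trans (hu _ _) _; rewrite er ltcR.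
  have := harmonic_le Nn; rewrite -subr_ge0 => h.
  have := mulr_ge0 h c0; lra.
have /cauchy_cvg/cvg_ex[l] := cu => /cvgrPdistC_le hl.
exists l => n; apply/ler_addgt0Pr => e e0.
have /complex_gt0E[r0 er] := e0.
have e20 : 0 < e / 2 by rewrite divr_gt0.
have [N _ hN] := hl _ e20.
have r20 : 0 < complex.Re e / 2 by rewrite divr_gt0.
have [M hM] := harmonic_small c0 r20.
pose m := maxn N M.
have -> : u n - l = (u n - u m) + (u m - l) by rewrite addrA subrK.
apply: le_trans (ler_normD _ _) _.
rewrite [in leRHS](splitr e) addrA; apply: lerD; last exact/hN/leq_maxl.
apply: le_trans (hu _ _) _.
have -> : e / 2 = (complex.Re e / 2)%:C.
  by rewrite rmorphM fmorphV rmorph_nat /= -er.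
rewrite -rmorphD lecR.
have := harmonic_le (leq_maxr N M); rewrite -/m -subr_ge0 => h.
have := mulr_ge0 h c0; lra.
Qed.

Lemma harmonic_lim_unique x y c : 0 <= c ->
  (forall n, `|x - y| <= (s n * c)%:C) -> x = y.
Proof.
move=> c0 hxy; apply/eqP; rewrite -subr_eq0 -normr_le0.
apply/ler_addgt0Pr => e /complex_gt0E[r0 ->]; rewrite add0r.
have [N /ltW hN] := harmonic_small c0 r0.
by apply: le_trans (hxy N) _; rewrite lecR.
Qed.

Lemma norm_real x : exists2 r : R, 0 <= r & `|x| = r%:C.
Proof.
exists (complex.Re `|x|); last by rewrite RRe_real.
by rewrite -ler0c RRe_real.
Qed.

Lemma op_norm_leD A B a b :
  op_norm_le A a -> op_norm_le B b -> op_norm_le (A + B) (a + b).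
Proof.
move=> hA hB x; apply: le_trans (ler_normD _ _) _.
by rewrite rmorphD mulrDl; apply: lerD; [exact: hA|exact: hB].
Qed.

Lemma op_norm_leN A a : op_norm_le A a -> op_norm_le (- A) a.
Proof. by move=> hA x; rewrite opN normrN. Qed.

Lemma op_norm_le_trans A a b : a <= b -> op_norm_le A a -> op_norm_le A b.
Proof.
by move=> ab hA x; apply: le_trans (hA x) _; rewrite ler_wpM2r// lecR.
Qed.

Lemma op_norm_leM A B a b : 0 <= a ->
  op_norm_le A a -> op_norm_le B b -> op_norm_le (A * B) (a * b).
Proof.
move=> a0 hA hB x; apply: le_trans (hA _) _.
by rewrite rmorphM -mulrA ler_wpM2l// ler0c.
Qed.

Lemma op_norm_le0 A : (forall e, 0 < e -> op_norm_le A e) -> A = 0.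
Proof.
move=> hA; apply: bounded_opP => x; apply: sq_eq0; apply/le_anti.
rewrite sq_ge0 andbT; apply/ler_addgt0Pr => e e0; rewrite add0r.
(* The first bound gives [d ^+ 2 <= d], the second [d * sq x <= e]. *)
pose d := Num.min 1 (e / (1 + sq x)).
have x1 : 0 < 1 + sq x by rewrite ltr_pwDl// sq_ge0.
have d0 : 0 < d by rewrite lt_min ltr01 divr_gt0.
have /op_norm_leP - /(_ (ltW d0) x) h := hA _ d0.
apply: le_trans h _; apply: (@le_trans _ _ (d * sq x)).
  rewrite ler_wpM2r ?sq_ge0// expr2; apply: ler_piMr; first exact: ltW.
  by rewrite /d ge_min lexx.
apply: (@le_trans _ _ (e / (1 + sq x) * sq x)).
  by rewrite ler_wpM2r ?sq_ge0// /d ge_min lexx orbT.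
by rewrite mulrAC ler_pdivrMr// ler_pM2l// lerDr.
Qed.

Lemma op_norm_le_ex A : exists2 a, 0 < a & op_norm_le A a.
Proof.
have [c hc] := bounded_op_bounded A; exists (`|c| + 1).
  by rewrite ltr_wpDl.
by apply: op_norm_le_trans hc; have := ler_norm c; lra.
Qed.

(** The pointwise limits are reached at a rate proportional to the norm of [x]. Comparison with
    [T n] then makes the limit linear, and comparison with [T 0] makes it bounded. *)
Lemma op_complete (T : nat -> bounded_op H) :
  (forall n m, op_norm_le (T n - T m) (s n + s m)) ->
  exists X, forall n, op_norm_le (T n - X) (s n).
Proof.
move=> hT.
have /choice[X hX] x : exists l, forall n, `|T n x - l| <= (s n)%:C * `|x|.
  have [r r0 xr] := norm_real x.
  have [|l hl] := @harmonic_cauchy_lim (fun n => T n x) r r0.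
    by move=> n m; have := hT n m x; rewrite xr -rmorphM.
  by exists l => n; rewrite xr -rmorphM.
have linX : linear X.
  move=> z x y; have [r r0 xr] := norm_real x; have [t t0 yt] := norm_real y.
  have [q q0 zq] : exists2 q : R, 0 <= q & `|z| = q%:C.
    by rewrite normc_def; exists (Num.sqrt (complex.Re z ^+ 2 + complex.Im z ^+ 2)).
  have [w w0 xyw] := norm_real (z *: x + y).
  apply: (@harmonic_lim_unique _ _ (w + q * r + t)) => [|n].
    by rewrite !addr_ge0// mulr_ge0.
  have idm (a u v b d : H) : a - (u + v) = - ((b + d) - a) + ((b - u) + (d - v)).
    by rewrite opprB [X in _ = _ + X]addrACA -opprD [RHS]addrA subrK.
  have -> : X (z *: x + y) - (z *: X x + X y) =
     - (T n (z *: x + y) - X (z *: x + y)) + (z *: (T n x - X x) + (T n y - X y)).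
    rewrite (bounded_op_linear (T n)) scalerBr.
    exact: idm.
  apply: le_trans (ler_normD _ _) _; rewrite normrN.
  apply: (@le_trans _ _ ((s n)%:C * w%:C + (q%:C * ((s n)%:C * r%:C) + (s n)%:C * t%:C))).
    apply: lerD; first by rewrite -xyw hX.
    apply: le_trans (ler_normD _ _) _; rewrite normrZ zq; apply: lerD.
      by rewrite ler_wpM2l// ?ler0c// -xr hX.
    by rewrite -yt hX.
  by rewrite -!rmorphM -!rmorphD lecR; lra.
have bX : X \in @bounded_linear R H.
  apply/asboolP; split=> //; have [a a0 ha] := op_norm_le_ex (T 0%N).
  exists (s 0 + a) => x; rewrite -(subrK (T 0%N x) (X x)).
  apply: le_trans (ler_normD _ _) _; rewrite rmorphD mulrDl distrC.
  exact/lerD/ha/hX.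
by exists (BoundedOp bX) => n x; exact: hX.
Qed.

Lemma sa_lim X : (forall e, 0 < e -> exists2 T, sa T & op_norm_le (T - X) e) ->
  sa X.
Proof.
move=> hX x y; apply/eqP; rewrite -subr_eq0 -normr_le0.
apply/ler_addgt0Pr => e e0; rewrite add0r.
pose k := sq x + sq y + 1.
have k0 : 0 < k by rewrite ltr_wpDl// addr_ge0 ?sq_ge0.
have d0 : 0 < e / k by rewrite divr_gt0.
have [T hT TX] := hX _ d0.
have -> : rp (X x) y - rp x (X y) = rp x ((T - X) y) - rp ((T - X) x) y.
  by rewrite !opE !rpE hT; ring.
have h u v : 2 * `|rp ((T - X) u) v| <= (e / k) * (sq u + sq v).
  have id0 : 0 < (e / k)^-1 by rewrite invr_gt0.
  have := AMGM_rp ((T - X) u) v id0; rewrite invrK => h1.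
  have /op_norm_leP -/(_ (ltW d0) u) := TX.
  rewrite -(ler_pM2l id0) expr2 -mulrA mulKf ?gt_eqF// => h2; lra.
have := h x y; have := h y x; rewrite [rp _ x]rpC => h1 h2.
apply: le_trans (ler_normB _ _) _.
have : (e / k) * (sq x + sq y) <= e.
  by rewrite mulrAC ler_pdivrMr// ler_pM2l// lerDl.
lra.
Qed.

Lemma rp_lim X x c :
  (forall e, 0 < e -> exists2 T : bounded_op H, c - e <= rp (T x) x & op_norm_le (T - X) e) ->
  c <= rp (X x) x.
Proof.
move=> hX; apply/ler_addgt0Pr => e e0.
have k0 : 0 < sq x + 1 by rewrite ltr_wpDl// sq_ge0.
have d0 : 0 < e / (sq x + 1) by rewrite divr_gt0.
have [T cT TX] := hX _ d0.
have := rp_bound x d0 TX; rewrite !opE !rpE => h.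
have E : e / (sq x + 1) * (sq x + 1) = e by rewrite divfK// gt_eqF.
have := ler_norm (rp (T x) x - rp (X x) x); lra.
Qed.

End OperatorLimits.

(** * Bernstein polynomials *)

Section Bernstein.
Variable R : realType.
Implicit Types (x y a b c e : R) (f g : nat -> R) (n k : nat).

Definition bern n k : {poly R} := ('X^k * (1 - 'X) ^+ (n - k)) *+ 'C(n, k).

Definition bern_sum n f : {poly R} := \sum_(k < n.+1) (f k)%:P * bern n k.

Lemma bernS0 n : bern n.+1 0 = (1 - 'X) * bern n 0.
Proof. by rewrite /bern !bin0 !subn0 !mulr1n expr0 !mul1r exprS. Qed.

Lemma bern_gtn n k : (n < k)%N -> bern n k = 0.
Proof. by move=> nk; rewrite /bern bin_small. Qed.

Lemma bernSS n k : bern n.+1 k.+1 = (1 - 'X) * bern n k.+1 + 'X * bern n k.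
Proof.
rewrite /bern binS mulrnDr subSS; congr (_ + _); last first.
  by rewrite exprS -mulrA mulrnAr.
have [kn|nk] := ltnP k n; last by rewrite bin_small// !mulr0n mulr0.
by rewrite -{1}(subnSK kn) [(1 - 'X) ^+ _.+1]exprS mulrCA mulrnAr.
Qed.

(** Pascal's rule as a recursion on the degree; the moments below follow from it by induction. *)
Lemma bern_sumS n f :
  bern_sum n.+1 f = (1 - 'X) * bern_sum n f + 'X * bern_sum n (f \o S).
Proof.
rewrite {1}/bern_sum big_ord_recl bernS0.
under eq_bigr do rewrite lift0 bernSS mulrDr mulrCA [X in _ + X]mulrCA.
rewrite big_split /= -!mulr_sumr addrA; congr (_ + _).
rewrite mulrCA -mulrDr; congr (_ * _).
(* One more term may be added at the top, since [bern n n.+1] is 0. *)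
transitivity (\sum_(k < n.+2) (f k)%:P * bern n k).
  by rewrite [RHS]big_ord_recl.
by rewrite big_ord_recr /= bern_gtn// mulr0 addr0.
Qed.

Lemma bern_sumD n f g :
  bern_sum n (fun k => f k + g k) = bern_sum n f + bern_sum n g.
Proof. by rewrite -big_split; apply: eq_bigr => k _; rewrite polyCD mulrDl. Qed.

Lemma bern_sumZ n c f : bern_sum n (fun k => c * f k) = c%:P * bern_sum n f.
Proof. by rewrite mulr_sumr; apply: eq_bigr => k _; rewrite polyCM mulrA. Qed.

Lemma bern_sum1 n : bern_sum n (fun=> 1) = 1.
Proof.
elim: n => [|n IH].
  by rewrite /bern_sum big_ord1 /bern subn0 bin0 mulr1n !expr0 !mulr1.
by rewrite bern_sumS IH !mulr1 subrK.
Qed.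

Lemma bern_sumX n : bern_sum n (fun k => k%:R) = n%:R%:P * 'X.
Proof.
elim: n => [|n IH]; first by rewrite /bern_sum big_ord1 polyC0 !mul0r.
rewrite bern_sumS IH.
have -> : bern_sum n ((fun k => k%:R) \o S) = n%:R%:P * 'X + 1.
  rewrite -IH -[X in _ = _ + X](bern_sum1 n) -bern_sumD.
  by apply: eq_bigr => k _; rewrite /= -natr1.
by rewrite -[in RHS]natr1 polyCD; ring.
Qed.

Lemma bern_sumXX n :
  bern_sum n (fun k => k%:R ^+ 2) = (n%:R * (n%:R - 1))%:P * 'X ^+ 2 + n%:R%:P * 'X.
Proof.
elim: n => [|n IH].
  by rewrite /bern_sum big_ord1 expr0n /= !mul0r addr0.
rewrite bern_sumS IH.
have -> : bern_sum n ((fun k => k%:R ^+ 2) \o S) =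
    bern_sum n (fun k => k%:R ^+ 2) + 2%:P * bern_sum n (fun k => k%:R) + bern_sum n (fun=> 1).
  rewrite -bern_sumZ -!bern_sumD; apply: eq_bigr => k _ /=.
  by congr (_%:P * _); rewrite -natr1; ring.
rewrite IH bern_sumX bern_sum1.
rewrite -[in RHS]natr1 !polyCM !polyCB !polyCD; ring.
Qed.

Lemma bern_ge0 n k x : 0 <= x <= 1 -> 0 <= (bern n k).[x].
Proof.
move=> /andP[x0 x1]; rewrite /bern hornerMn mulrn_wge0// hornerM hornerXn horner_exp.
by rewrite mulr_ge0 ?exprn_ge0// !hornerE subr_ge0.
Qed.

Lemma bern_sum_horner n f x :
  (bern_sum n f).[x] = \sum_(k < n.+1) f k * (bern n k).[x].
Proof.
by rewrite horner_sum; apply: eq_bigr => k _; rewrite hornerM hornerC.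
Qed.

(** The variance of a binomial frequency: expand the square and insert the moments of order 0, 1 and
    2. *)
Lemma bern_variance n x :
  \sum_(k < n.+2) (k%:R / n.+1%:R - x) ^+ 2 * (bern n.+1 k).[x] = x * (1 - x) / n.+1%:R.
Proof.
set N : R := n.+1%:R; have N0 : N != 0 by rewrite pnatr_eq0.
transitivity ((bern_sum n.+1 (fun k =>
    N^-1 ^+ 2 * k%:R ^+ 2 + (- (2 * x / N)) * k%:R + x ^+ 2 * 1)).[x]).
  rewrite bern_sum_horner; apply: eq_bigr => k _; congr (_ * _).
  by rewrite mulr1; ring.
rewrite !bern_sumD !bern_sumZ bern_sum1 bern_sumX bern_sumXX -/N !hornerE /=.
by field.
Qed.

(** Since [(e - L * |d|) ^+ 2 >= 0], one has [L * |d| <= e / 2 + C * d ^+ 2]. Averaged with the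
    Bernstein weights, the error is at most [e / 2] plus [C] times the variance, and the degree
    makes the latter small. *)
Lemma weierstrass01 (f : R -> R) (L e : R) : 0 < e -> 
  (forall x y, 0 <= x <= 1 -> 0 <= y <= 1 -> `|f x - f y| <= L * `|x - y|) ->
  exists p : {poly R}, forall x, 0 <= x <= 1 -> `|p.[x] - f x| <= e.
Proof.
move=> e0 fL.
pose C := L ^+ 2 / (2 * e).
have C0 : 0 <= C by rewrite divr_ge0 ?sqr_ge0// mulr_ge0// ltW.
have [n hn] : exists n, C / n.+1%:R < e / 2.
  have [n hn] := @harmonic_small _ C (e / 2) C0 (divr_gt0 e0 (ltr0n R 2)).
  by exists n; rewrite mulrC.
exists (bern_sum n.+1 (fun k => f (k%:R / n.+1%:R))) => x x01.
have b0 k := bern_ge0 n.+1 k x01.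
have one : \sum_(k < n.+2) (bern n.+1 k).[x] = 1.
  have := bern_sum_horner n.+1 (fun=> 1) x; rewrite bern_sum1 hornerC => ->.
  by apply: eq_bigr => k _; rewrite mul1r.
rewrite bern_sum_horner -[f x]mulr1 -[X in _ - f x * X]one mulr_sumr -sumrB.
apply: le_trans (ler_norm_sum _ _ _) _.
apply: (@le_trans _ _ (\sum_(k < n.+2) (e / 2 * (bern n.+1 k).[x] +
    C * ((k%:R / n.+1%:R - x) ^+ 2 * (bern n.+1 k).[x])))).
  apply: ler_sum => k _; rewrite -mulrBl normrM (ger0_norm (b0 k)) mulrA -mulrDl.
  rewrite ler_wpM2r//.
  have k01 : 0 <= (k%:R / n.+1%:R : R) <= 1.
    rewrite divr_ge0//= ler_pdivrMr// mul1r ler_nat -ltnS; exact: ltn_ord.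
  apply: le_trans (fL _ _ k01 x01) _.
  set d : R := (k%:R / n.+1%:R - x).
  have := sqr_ge0 (e - L * `|d|); rewrite -(real_normK (num_real d)).
  move: `|d| => {}d h.
  rewrite -(ler_pM2l (_ : 0 < 2 * e)) ?mulr_gt0//.
  rewrite mulrDr mulrA (mulrCA (2 * e)) /C.
  have -> : 2 * e * (L ^+ 2 / (2 * e) * d ^+ 2) = L ^+ 2 * d ^+ 2.
    by field; rewrite gt_eqF.
  lra.
rewrite big_split /= -!mulr_sumr one bern_variance.
have : x * (1 - x) <= 1 by nra.
move/andP: x01 => [x0 x1].
have N0 : 0 < (n.+1%:R : R)^-1 by rewrite invr_gt0.
move: hn N0; set N := _^-1 => hn N0 xx.
have : C * (x * (1 - x) * N) <= C * N.
  by rewrite ler_wpM2l// ler_piMl// ltW.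
lra.
Qed.

Lemma weierstrass (f : R -> R) (a b L e : R) : a < b -> 0 < e ->
  (forall x y, a <= x <= b -> a <= y <= b -> `|f x - f y| <= L * `|x - y|) ->
  exists p : {poly R}, forall x, a <= x <= b -> `|p.[x] - f x| <= e.
Proof.
move=> ab e0 fL; have ba : 0 < b - a by rewrite subr_gt0.
have [||p hp] := @weierstrass01 (fun u => f (a + (b - a) * u)) (L * (b - a)) e.
- by [].
- move=> x y /andP[x0 x1] /andP[y0 y1].
  have := fL (a + (b - a) * x) (a + (b - a) * y).
  have -> : a + (b - a) * x - (a + (b - a) * y) = (b - a) * (x - y) by ring.
  rewrite normrM (gtr0_norm ba) mulrA; apply; nra.
exists (p \Po ((b - a)^-1%:P * ('X - a%:P))) => x /andP[ax xb].
have -> : (p \Po ((b - a)^-1%:P * ('X - a%:P))).[x] = p.[(b - a)^-1 * (x - a)].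
  by rewrite horner_comp !hornerE.
have := hp ((b - a)^-1 * (x - a)).
rewrite mulVKf ?gt_eqF// [a + (x - a)]addrC subrK; apply.
rewrite mulr_ge0 ?subr_ge0//=; last by rewrite invr_ge0 ltW.
by rewrite ler_pdivrMl// mulr1 lerD2r.
Qed.

End Bernstein.

(** * Continuous functional calculus *)

Section FunctionalCalculus.
Variables (R : realType) (H : hilbertType R).
Implicit Types (x y : H) (a b c e : R) (A B T X Y : bounded_op H).
Implicit Types (p q : {poly R}) (f g : R -> R).

Definition op_between a A b := [/\ sa A, forall x, a * sq x <= rp (A x) x
  & forall x, rp (A x) x <= b * sq x].

Definition unif_close a b e f g := forall u, a <= u <= b -> `|f u - g u| <= e.

(** Unlike in [is_op_fun], polynomials approximate [f] on an interval instead of the spectrum, and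
    one polynomial per precision is enough. [fcalc_op_fun] gives the passage back to [op_fun]. *)
Definition fcalc a b A f X := forall e, 0 < e -> exists2 p : {poly R},
  unif_close a b e (fun u => p.[u]) f & op_norm_le (op_poly p A - X) e.

Lemma op_norm_le_lim A e : (forall d, 0 < d -> op_norm_le A (e + d)) -> op_norm_le A e.
Proof.
move=> hA x; apply/ler_addgt0Pr => z /complex_gt0E[r0 ->].
have [r rx xr] := norm_real x.
have r1 : 0 < r + 1 by rewrite ltr_wpDl.
have d0 : 0 < complex.Re z / (r + 1) by rewrite divr_gt0.
apply: le_trans (hA _ d0 x) _.
rewrite xr -!rmorphM -rmorphD lecR mulrDl lerD2l mulrAC ler_pdivrMr//.
by rewrite ler_pM2l// lerDl.
Qed.

Lemma op_poly_between a b A p e : op_between a A b -> 0 < e ->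
  (forall u, a <= u <= b -> `|p.[u]| <= e) -> op_norm_le (op_poly p A) e.
Proof.
move=> [hA aA Ab] e0 hp; apply: op_poly_norm_le => // u pu.
apply: (bounded_below_outside hA aA Ab).
rewrite !ltNge -negb_and; apply: contraL pu => /hp.
by rewrite -leNgt.
Qed.

Lemma fcalc_dist a b A f g X Y e : op_between a A b -> 0 < e ->
  fcalc a b A f X -> fcalc a b A g Y -> unif_close a b e f g ->
  op_norm_le (X - Y) e.
Proof.
move=> hA e0 hf hg fg; apply: op_norm_le_lim => d d0.
have d4 : 0 < d / 4 by rewrite divr_gt0.
have [p pf pX] := hf _ d4; have [q qg qY] := hg _ d4.
have pq : op_norm_le (op_poly (p - q) A) (e + d / 4 + d / 4).
  apply: op_poly_between hA _ _ => [|u uab]; first by rewrite !addr_gt0.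
  rewrite hornerD hornerN; have := pf u uab; have := qg u uab; have := fg u uab.
  by rewrite !ler_norml => /andP[? ?] /andP[? ?] /andP[? ?]; lra.
have -> : X - Y = - (op_poly p A - X) + op_poly (p - q) A + (op_poly q A - Y).
  by rewrite op_polyB opprB !addrA !subrK.
apply: op_norm_le_trans (op_norm_leD (op_norm_leD (op_norm_leN pX) pq) qY).
lra.
Qed.

Lemma fcalc_unique a b A f g X Y : op_between a A b ->
  fcalc a b A f X -> fcalc a b A g Y -> (forall u, a <= u <= b -> f u = g u) ->
  X = Y.
Proof.
move=> hA hf hg fg; apply/eqP; rewrite -subr_eq0; apply/eqP.
apply: op_norm_le0 => e e0; apply: (fcalc_dist hA e0 hf hg) => u uab.
by rewrite fg// subrr normr0 ltW.
Qed.

Lemma fcalc_poly a b A p : fcalc a b A (fun u => p.[u]) (op_poly p A).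
Proof.
move=> e e0; exists p; first by move=> u _; rewrite subrr normr0 ltW.
by move=> x; rewrite subrr op0 normr0 mulr_ge0// ler0c ltW.
Qed.

Lemma fcalc_bounded a b A f X : fcalc a b A f X ->
  exists2 c, 0 < c & forall u, a <= u <= b -> `|f u| <= c.
Proof.
move=> /(_ _ ltr01)[p pf _]; have [c hc] := poly_itv_bound p a b.
exists (`|c| + 1) => [|u uab]; first by rewrite ltr_wpDl.
have := hc u uab; have := ler_norm c; have := pf u uab.
have := ler_normB p.[u] (p.[u] - f u); rewrite subKr; lra.
Qed.

Lemma fcalcM a b A f g X Y : fcalc a b A f X -> fcalc a b A g Y ->
  fcalc a b A (fun u => f u * g u) (X * Y).
Proof.
move=> hf hg e e0.
have [F F0 hF] := fcalc_bounded hf; have [G G0 hG] := fcalc_bounded hg.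
have [cx x0 hx] := op_norm_le_ex X; have [cy y0 hy] := op_norm_le_ex Y.
(* [k] collects the coefficients of [d] in both the scalar and the operator estimate; [d <= 1]
   absorbs the product of two errors. *)
pose k := F + G + cx + cy + 1.
have k0 : 0 < k by rewrite /k; lra.
pose d := Num.min 1 (e / k).
have d0 : 0 < d by rewrite lt_min ltr01 divr_gt0.
have d1 : d <= 1 by rewrite /d ge_min lexx.
have dk : d * k <= e by rewrite -ler_pdivlMr// /d ge_min lexx orbT.
have [p pf pX] := hf _ d0; have [q qg qY] := hg _ d0.
exists (p * q).
  move=> u uab /=; rewrite hornerM.
  have -> : p.[u] * q.[u] - f u * g u =
    (p.[u] - f u) * (q.[u] - g u) + (p.[u] - f u) * g u + f u * (q.[u] - g u) by ring.
  apply: le_trans (ler_normD _ _) _.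
  apply: le_trans (lerD (ler_normD _ _) (lexx _)) _; rewrite !normrM.
  have h1 : `|p.[u] - f u| * `|q.[u] - g u| <= d * 1.
    by apply: ler_pM => //; [exact: pf|apply: le_trans (qg _ uab) _].
  have h2 : `|p.[u] - f u| * `|g u| <= d * G.
    by apply: ler_pM => //; [exact: pf|exact: hG].
  have h3 : `|f u| * `|q.[u] - g u| <= F * d.
    by apply: ler_pM => //; [exact: hF|exact: qg].
  have := mulr_gt0 d0 x0; have := mulr_gt0 d0 y0; move: dk; rewrite /k; lra.
have -> : op_poly (p * q) A - X * Y = (op_poly p A - X) * (op_poly q A - Y) +
    (op_poly p A - X) * Y + X * (op_poly q A - Y).
  by rewrite -mulrDr subrK mulrBl mulrBr addrA subrK op_polyM.
have := op_norm_leD (op_norm_leD (op_norm_leM (ltW d0) pX qY)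
  (op_norm_leM (ltW d0) pX hy)) (op_norm_leM (ltW x0) hx qY).
apply: op_norm_le_trans.
have : d * d <= d * 1 by rewrite ler_pM2l.
have := mulr_gt0 d0 F0; have := mulr_gt0 d0 G0; move: dk; rewrite /k; lra.
Qed.

Lemma fcalc_sa a b A f X : op_between a A b -> fcalc a b A f X -> sa X.
Proof.
move=> [hA _ _] hf; apply: sa_lim => e /hf[p _ pX].
by exists (op_poly p A) => //; exact: sa_op_poly.
Qed.

(** An approximating polynomial exceeds [c] minus its error on [[a, b]]; [op_poly_ge0] transfers
    this to the operator, and [rp_lim] removes the error. *)
Lemma fcalc_ge a b A f X c : op_between a A b -> fcalc a b A f X ->
  (forall u, a <= u <= b -> c <= f u) -> forall x, c * sq x <= rp (X x) x.
Proof.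
move=> hA hf fc x; apply: rp_lim => e e0.
have k0 : 0 < 1 + sq x by rewrite ltr_pwDl ?sq_ge0.
have d0 : 0 < e / (1 + sq x) by rewrite divr_gt0.
have [p pf pX] := hf _ d0; exists (op_poly p A); last first.
  by apply: op_norm_le_trans pX; rewrite ler_pdivrMr//; apply: ler_peMr;
    [exact: ltW|rewrite lerDl sq_ge0].
have [sA aA Ab] := hA.
have : 0 <= rp (op_poly (p - (c - e / (1 + sq x))%:P) A x) x.
  apply: op_poly_ge0 => // u; rewrite hornerD hornerN hornerC => pu.
  apply: (bounded_below_outside sA aA Ab).
  rewrite !ltNge -negb_and; apply/negP => uab.
  have := pf u uab; rewrite ler_norml => /andP[h1 h2]; have := fc u uab; lra.
rewrite op_polyB op_polyC !opE !rpE -/(sq x) subr_ge0; apply: le_trans.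
rewrite mulrBl lerD2l lerN2 mulrAC ler_pdivrMr// ler_pM2l// lerDr.
exact: ler01.
Qed.

Lemma fcalc_le a b A f X c : op_between a A b -> fcalc a b A f X ->
  (forall u, a <= u <= b -> f u <= c) -> forall x, rp (X x) x <= c * sq x.
Proof.
move=> hA hf fc x.
have hNf : fcalc a b A (fun u => (-1)%:P.[u] * f u) (op_poly (-1)%:P A * X).
  exact/fcalcM/hf/fcalc_poly.
have hc u : a <= u <= b -> - c <= (-1)%:P.[u] * f u.
  by move=> uab; rewrite hornerC mulN1r lerN2 fc.
have := fcalc_ge hA hNf hc x.
by rewrite op_polyC !opE rpZl mulN1r mulNr lerN2.
Qed.

(** Weierstrass polynomials chosen at the rate [harm] form a Cauchy sequence after evaluation at
    [A]. *)
Lemma fcalc_lipschitz_ex a b A f L : op_between a A b -> a < b ->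
  (forall u v, a <= u <= b -> a <= v <= b -> `|f u - f v| <= L * `|u - v|) ->
  exists X, fcalc a b A f X.
Proof.
move=> hA ab fL.
have /choice[P hP] n : exists p, unif_close a b (harm R n) (fun u => p.[u]) f.
  by have [p hp] := weierstrass ab (harmonic_gt0 R n) fL; exists p.
have [n m|X hX] := @op_complete _ _ (fun n => op_poly (P n) A).
  rewrite -op_polyB; apply: op_poly_between hA _ _ => [|u uab].
    by rewrite addr_gt0 ?harmonic_gt0.
  rewrite hornerD hornerN; have := hP n u uab; have := hP m u uab.
  by rewrite !ler_norml => /andP[? ?] /andP[? ?]; lra.
exists X => e e0; have [n hn] := @harmonic_small R 1 e ler01 e0.
rewrite mulr1 in hn; exists (P n); last exact: op_norm_le_trans (ltW hn) (hX n).
by move=> u uab; apply: le_trans (hP n u uab) (ltW hn).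
Qed.

Lemma op_between_widen a b c A : op_between a A b -> b <= c -> op_between a A c.
Proof.
move=> [hA aA Ab] bc; split=> // x.
by apply: le_trans (Ab x) _; rewrite ler_wpM2r// sq_ge0.
Qed.

(** The function [u^-1] is Lipschitz on [[a, c]], and multiplicativity of the calculus makes its
    value at [A] an inverse. *)
Lemma op_between_invertible a b A : 0 < a -> op_between a A b -> op_invertible A.
Proof.
(* Weierstrass approximation asks for a nondegenerate interval, hence [c > a]. *)
move=> a0 hA0; pose c := Num.max b (a + 1).
have hA : op_between a A c by apply: op_between_widen hA0 _; rewrite le_max lexx.
have ac : a < c by rewrite lt_max [a < a + 1]ltrDl ltr01 orbT.
have [u v /andP[au _] /andP[av _]|X hX] :=
    @fcalc_lipschitz_ex _ _ _ (fun u => u^-1) (a^-1 ^+ 2) hA ac.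
  have u0 : 0 < u by apply: lt_le_trans au.
  have v0 : 0 < v by apply: lt_le_trans av.
  have -> : u^-1 - v^-1 = u^-1 * v^-1 * (v - u) by field; rewrite !gt_eqF.
  have vi0 : 0 <= v^-1 by rewrite invr_ge0 ltW.
  have ui0 : 0 <= u^-1 by rewrite invr_ge0 ltW.
  rewrite normrM distrC ler_wpM2r// ger0_norm ?mulr_ge0// expr2.
  by rewrite ler_pM// lef_pV2.
have hid : fcalc a c A (fun u => 'X.[u]) A.
  by rewrite -{2}(op_polyX A); exact: fcalc_poly.
have h1 : fcalc a c A (fun u => 1.[u]) 1.
  by rewrite -(op_poly1 A); exact: fcalc_poly.
have hu u : a <= u <= c -> u != 0.
  by move=> /andP[au _]; rewrite gt_eqF// (lt_le_trans a0).
exists X; split.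
  apply: (fcalc_unique hA (fcalcM hX hid) h1) => u /hu u0.
  by rewrite hornerX hornerC mulVf.
apply: (fcalc_unique hA (fcalcM hid hX) h1) => u /hu u0.
by rewrite hornerX hornerC mulfV.
Qed.

Lemma op_invertibleN A : op_invertible A -> op_invertible (- A).
Proof. by move=> [X [XA AX]]; exists (- X); split; rewrite mulrNN. Qed.

Lemma spectrum_between a b A u : op_between a A b -> spectrum A u%:C -> a <= u <= b.
Proof.
move=> [hA aA Ab]; apply: contraPT; rewrite negb_and -!ltNge => hu; apply.
have rE x : rp ((A - op_scalar u) x) x = rp (A x) x - u * sq x.
  by rewrite !opE !rpE.
have sE : sa (A - op_scalar u) by apply/saB/sa_scalar.
case/orP: hu => hu.
  apply: (@op_between_invertible (a - u) (b - u)); first by rewrite subr_gt0.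
  by split=> // x; rewrite rE; [have := aA x|have := Ab x]; lra.
rewrite -[X in op_invertible X]opprK; apply: op_invertibleN.
apply: (@op_between_invertible (u - b) (u - a)); first by rewrite subr_gt0.
by split=> [|x|x]; [exact: saN|..]; rewrite opN rpNl rE; [have := Ab x|have := aA x]; lra.
Qed.

(** The spectrum lies in [[a, b]], so approximation on the interval is approximation on the
    spectrum; this gives uniqueness. For existence, [op_poly_norm_le] compares two polynomials only
    at points where [A - u] is not bounded below, and these are spectral. Hence the default value of
    [op_fun] does not occur. *)
Lemma fcalc_op_fun a b A f X : op_between a A b -> fcalc a b A f X ->
  op_fun f A = X.
Proof.
move=> hA hf; have [sA _ _] := hA.
apply: xget_unique => /=.
  move=> e e0; exists (e / 2); first by rewrite divr_gt0.
  move=> p hp; have e8 : 0 < e / 8 by rewrite divr_gt0.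
  have [q qf qX] := hf _ e8.
  have pq : op_norm_le (op_poly (p - q) A) (e / 2 + e / 8).
    apply: op_poly_norm_le => // [|u]; first by rewrite addr_gt0// divr_gt0.
    rewrite hornerD hornerN => pqu.
    have [//|uA] := pselect (bounded_below (A - op_scalar u)).
    have su : spectrum A u%:C by move=> /op_invertible_bounded_below.
    have := hp u su; have := qf u (spectrum_between hA su).
    move: pqu; rewrite ltNge => /negP; rewrite !ler_norml => h.
    by move=> /andP[? ?] /andP[? ?]; exfalso; apply: h; apply/andP; split; lra.
  have -> : op_poly p A - X = op_poly (p - q) A + (op_poly q A - X).
    by rewrite op_polyB addrA subrK.
  by apply: op_norm_le_trans (op_norm_leD pq qX); lra.
move=> Y hY; apply/eqP; rewrite -subr_eq0; apply/eqP/op_norm_le0 => e e0.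
have e2 : 0 < e / 2 by rewrite divr_gt0.
have [d d0 hd] := hY _ e2.
pose r := Num.min d (e / 2); have r0 : 0 < r by rewrite lt_min d0.
have [q qf qX] := hf _ r0.
have qY : op_norm_le (op_poly q A - Y) (e / 2).
  apply: hd => u /(spectrum_between hA) uab; apply: le_trans (qf u uab) _.
  by rewrite ge_min lexx.
have -> : Y - X = - (op_poly q A - Y) + (op_poly q A - X).
  by rewrite opprB addrA subrK.
apply: op_norm_le_trans (op_norm_leD (op_norm_leN qY) qX).
by rewrite [leRHS]splitr lerD2l ge_min lexx orbT.
Qed.

End FunctionalCalculus.

(** * Real powers *)

Section RealPowers.
Variable R : realType.
Implicit Types (a b s r u v K D : R).

Lemma expR_lipschitz K u v : u <= K -> v <= K ->
  `|expR u - expR v| <= expR K * `|u - v|.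
Proof.
have key x y : x <= K -> y <= x -> expR x - expR y <= expR K * (x - y).
  move=> xK yx; have := expR_ge1Dx (y - x); rewrite expRD expRN.
  rewrite -(ler_pM2l (expR_gt0 x)) mulrCA mulfV ?mulr1 ?gt_eqF ?expR_gt0// => h.
  have : expR x * (x - y) <= expR K * (x - y).
    by rewrite ler_wpM2r ?subr_ge0// ler_expR.
  lra.
move=> uK vK; have [uv|/ltW vu] := leP u v.
  by rewrite distrC [`|u - v|]distrC !ger0_norm ?subr_ge0 ?ler_expR//; exact: key.
by rewrite !ger0_norm ?subr_ge0 ?ler_expR//; exact: key.
Qed.

Lemma ln_lipschitz a u v : 0 < a -> a <= u -> a <= v ->
  `|ln u - ln v| <= a^-1 * `|u - v|.
Proof.
have key x y : 0 < a -> a <= y -> y <= x -> ln x - ln y <= a^-1 * (x - y).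
  move=> a0 ay yx; have y0 : 0 < y by apply: lt_le_trans ay.
  have x0 : 0 < x by apply: lt_le_trans yx.
  rewrite -ln_div ?posrE//.
  have h : -1 < (x - y) / y by apply: (@lt_le_trans _ _ 0); [lra|rewrite divr_ge0 ?subr_ge0// ltW].
  have := le_ln1Dx h; have -> : 1 + (x - y) / y = x / y by field; rewrite gt_eqF.
  move/le_trans; apply; rewrite mulrC ler_wpM2r ?subr_ge0//.
  by rewrite lef_pV2.
move=> a0 au av.
have u0 : 0 < u by apply: lt_le_trans au.
have v0 : 0 < v by apply: lt_le_trans av.
have [uv|/ltW vu] := leP u v.
  by rewrite distrC [`|u - v|]distrC !ger0_norm ?subr_ge0 ?ler_ln ?posrE//; exact: key.
by rewrite !ger0_norm ?subr_ge0 ?ler_ln ?posrE//; exact: key.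
Qed.

Lemma powR_expR u s : 0 < u -> u `^ s = expR (s * ln u).
Proof. by move=> u0; rewrite /powR gt_eqF. Qed.

Definition ln_bound a b : R := `|ln a| + `|ln b|.

Lemma ln_bound_ge0 a b : 0 <= ln_bound a b.
Proof. exact: addr_ge0. Qed.

Lemma ln_le_bound a b u : 0 < a -> a <= u <= b -> `|ln u| <= ln_bound a b.
Proof.
move=> a0 /andP[au ub].
have u0 : 0 < u by apply: lt_le_trans au.
have b0 : 0 < b by apply: lt_le_trans ub.
have h1 : ln a <= ln u by rewrite ler_ln.
have h2 : ln u <= ln b by rewrite ler_ln.
rewrite /ln_bound ler_norml; have := ler_norm (ln b); have := ler_norm (- ln a).
rewrite normrN; have := normr_ge0 (ln a); have := normr_ge0 (ln b).
by move=> *; apply/andP; split; lra.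
Qed.

Lemma powR_arg_bound a b u s : 0 < a -> a <= u <= b ->
  `|s * ln u| <= `|s| * ln_bound a b.
Proof. by move=> a0 uab; rewrite normrM ler_wpM2l// ln_le_bound. Qed.

Lemma powR_lipschitz a b s u v : 0 < a -> a <= u <= b -> a <= v <= b ->
  `|u `^ s - v `^ s| <= expR (`|s| * ln_bound a b) * `|s| * a^-1 * `|u - v|.
Proof.
move=> a0 uab vab; have [/andP[au _] /andP[av _]] := (uab, vab).
rewrite !powR_expR ?(lt_le_trans a0)//.
have h w : a <= w <= b -> s * ln w <= `|s| * ln_bound a b.
  by move=> wab; apply: le_trans (ler_norm _) (powR_arg_bound s a0 wab).
apply: le_trans (expR_lipschitz (h _ uab) (h _ vab)) _.
rewrite -!mulrA ler_wpM2l ?expR_ge0// -mulrBr normrM ler_wpM2l//.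
exact: ln_lipschitz.
Qed.

(** The bound is uniform in [u], so it passes to operators and later carries an inequality from a
    dense set of exponents to all of them. *)
Lemma powR_exponent_lipschitz a b s r u : 0 < a -> a <= u <= b ->
  0 <= s <= 1 -> 0 <= r <= 1 ->
  `|u `^ s - u `^ r| <= expR (ln_bound a b) * ln_bound a b * `|s - r|.
Proof.
move=> a0 uab s01 r01; have /andP[au _] := uab.
rewrite !powR_expR ?(lt_le_trans a0)//.
have h w : 0 <= w <= 1 -> w * ln u <= ln_bound a b.
  move=> /andP[w0 w1]; apply: le_trans (ler_norm _) _.
  apply: le_trans (powR_arg_bound w a0 uab) _.
  by rewrite ger0_norm// ler_piMl// ln_bound_ge0.
apply: le_trans (expR_lipschitz (h _ s01) (h _ r01)) _.
rewrite -!mulrA ler_wpM2l ?expR_ge0// -mulrBl normrM mulrC ler_wpM2r//.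
exact: ln_le_bound.
Qed.

End RealPowers.

(** * Real powers of positive operators *)

Section OperatorPowers.
Variables (R : realType) (H : hilbertType R).
Implicit Types (x y : H) (a b c e s r t : R) (A B T X Y : bounded_op H).

(** Once [op_powR] is a value of [fcalc], its laws reduce to those of real powers. The interval is
    first widened to a nondegenerate one, then restricted again. *)
Lemma fcalc_powR a b A s : 0 < a -> op_between a A b ->
  fcalc a b A (fun u => u `^ s) (op_powR A s).
Proof.
move=> a0 hA; pose c := Num.max b (a + 1).
have bc : b <= c by rewrite le_max lexx.
have ac : a < c by rewrite lt_max [a < a + 1]ltrDl ltr01 orbT.
have hAc := op_between_widen hA bc.
have [X hX] := fcalc_lipschitz_ex hAc ac
  (fun u v => @powR_lipschitz _ a c s u v a0).
rewrite /op_powR (fcalc_op_fun hAc hX) => e /hX[p pf pX]; exists p => // u.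
by move=> /andP[au ub]; apply: pf; rewrite au (le_trans ub).
Qed.

(** Strict positivity with explicit bounds, which serve as the interval of the functional
    calculus. *)
Definition op_pos A := exists a b, 0 < a /\ op_between a A b.

Lemma op_pos_sa A : op_pos A -> sa A.
Proof. by move=> [a [b [_ []]]]. Qed.

Lemma op_pos_ge0 A x : op_pos A -> 0 <= rp (A x) x.
Proof.
move=> [a [b [a0 [_ aA _]]]]; apply: le_trans (aA x).
by rewrite mulr_ge0 ?sq_ge0// ltW.
Qed.

Lemma op_pos_invertible A : op_pos A -> op_invertible A.
Proof. by move=> [a [b [a0 hA]]]; exact: op_between_invertible hA. Qed.

Lemma op_powRD A s r : op_pos A -> op_powR A (s + r) = op_powR A s * op_powR A r.
Proof.
move=> [a [b [a0 hA]]].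
apply: (fcalc_unique hA (fcalc_powR _ a0 hA)
  (fcalcM (fcalc_powR s a0 hA) (fcalc_powR r a0 hA))) => u /andP[au _].
by rewrite powRD//; apply/implyP => _; rewrite gt_eqF// (lt_le_trans a0).
Qed.

Lemma op_powR0 A : op_pos A -> op_powR A 0 = 1.
Proof.
move=> [a [b [a0 hA]]]; rewrite -(op_poly1 A).
apply: (fcalc_unique hA (fcalc_powR _ a0 hA) (fcalc_poly a b A 1)) => u _.
by rewrite powRr0 hornerC.
Qed.

Lemma op_powR1 A : op_pos A -> op_powR A 1 = A.
Proof.
move=> [a [b [a0 hA]]]; rewrite -[RHS](op_polyX A).
apply: (fcalc_unique hA (fcalc_powR _ a0 hA) (fcalc_poly a b A 'X)) => u.
by move=> /andP[au _]; rewrite hornerX powRr1// (le_trans _ au)// ltW.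
Qed.

Lemma op_powR_between a A b s : 0 < a -> 0 <= s -> op_between a A b ->
  op_between (a `^ s) (op_powR A s) (b `^ s).
Proof.
move=> a0 s0 hA; have hf := fcalc_powR s a0 hA.
split; first exact: fcalc_sa hA hf.
  apply: (fcalc_ge hA hf) => u /andP[au ub].
  have u0 : 0 <= u by apply: le_trans au; exact: ltW.
  by apply: ge0_ler_powR; rewrite ?nnegrE// ltW.
apply: (fcalc_le hA hf) => u /andP[au ub].
have u0 : 0 <= u by apply: le_trans au; exact: ltW.
by apply: ge0_ler_powR; rewrite ?nnegrE// (le_trans u0).
Qed.

Lemma op_powR_pos A s : op_pos A -> op_pos (op_powR A s).
Proof.
move=> [a [b [a0 hA]]]; have hf := fcalc_powR s a0 hA.
exists (expR (- (`|s| * ln_bound a b))), (expR (`|s| * ln_bound a b)).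
split; first exact: expR_gt0.
have h u : a <= u <= b -> expR (- (`|s| * ln_bound a b)) <= u `^ s <= expR (`|s| * ln_bound a b).
  move=> uab; have /andP[au _] := uab.
  rewrite powR_expR ?(lt_le_trans a0)// !ler_expR -ler_norml.
  exact: powR_arg_bound.
split; first exact: fcalc_sa hA hf.
  by apply: (fcalc_ge hA hf) => u /h/andP[].
by apply: (fcalc_le hA hf) => u /h/andP[].
Qed.

Lemma op_powR_continuous A : op_pos A -> exists2 C, 0 < C &
  forall s r x, 0 <= s <= 1 -> 0 <= r <= 1 ->
  `|rp (op_powR A s x) x - rp (op_powR A r x) x| <= C * `|s - r| * sq x.
Proof.
move=> [a [b [a0 hA]]].
exists (expR (ln_bound a b) * ln_bound a b + 1).
  by rewrite ltr_wpDl// mulr_ge0 ?expR_ge0// ln_bound_ge0.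
move=> s r x s01 r01; have [->|sr] := eqVneq s r.
  by rewrite !subrr normr0 mulr0 mul0r.
have sr0 : 0 < `|s - r| by rewrite normr_gt0 subr_eq0.
have e0 : 0 < (expR (ln_bound a b) * ln_bound a b + 1) * `|s - r|.
  by rewrite mulr_gt0// ltr_wpDl// mulr_ge0 ?expR_ge0// ln_bound_ge0.
rewrite -rpNl -rpDl -opN -opD; apply: rp_bound => //.
apply: (fcalc_dist hA e0 (fcalc_powR s a0 hA) (fcalc_powR r a0 hA)) => u uab.
apply: le_trans (powR_exponent_lipschitz a0 uab s01 r01) _.
by rewrite mulrDl lerDl mul1r.
Qed.

Lemma op_inverse_unique A X Y : op_inverse A X -> op_inverse A Y -> X = Y.
Proof. by move=> [XA _] [_ AY]; rewrite -[X]mulr1 -AY mulrA XA mul1r. Qed.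

Lemma op_invE A X : op_inverse A X -> op_inv A = X.
Proof.
by move=> hX; apply: xget_unique => // Y hY; exact: op_inverse_unique hY hX.
Qed.

Lemma op_inv_powR A : op_pos A -> op_inv A = op_powR A (-1).
Proof.
move=> hA; apply: op_invE; split.
  by rewrite -{2}(op_powR1 hA) -op_powRD// addNr op_powR0.
by rewrite -{1}(op_powR1 hA) -op_powRD// subrr op_powR0.
Qed.

End OperatorPowers.

(** * Order and positive maps *)

Section OrderLemmas.
Variables (R : realType) (H : hilbertType R).
Implicit Types (x y : H) (a b c d e : R) (A B C E F T U V W X Y Z : bounded_op H).

(** Operator monotonicity of the square root. By [spectral_gap] it suffices that [l - (U - V)] be
    bounded below for [l > 0]. Put [r] for its value at [x] and [z = (V + l) x]: then [U x = z - r]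
    has square norm at most [sq (V x)], while [sq z >= sq (V x) + l ^+ 2 * sq x], so [r] cannot be
    small. *)
Lemma op_le_of_sq_le U V : sa U -> sa V -> (forall x, 0 <= rp (V x) x) ->
  (forall x, sq (U x) <= sq (V x)) -> forall x, rp (U x) x <= rp (V x) x.
Proof.
move=> hU hV V0 UV x; rewrite -subr_le0.
have -> : rp (U x) x - rp (V x) x = rp ((U - V) x) x by rewrite !opE !rpE.
move: x; apply: spectral_gap; first exact: saB.
move=> l l0; have [w w0 hw] := op_sq_bounded (V + op_scalar l).
exists (l ^+ 4 / (4 * w)) => [|x]; first by rewrite divr_gt0 ?exprn_gt0// mulr_gt0.
set r := (op_scalar l - (U - V)) x; set z := (V + op_scalar l) x.
have Ur : U x = z - r.
  have idm (u v w' : H) : u = v + w' - (w' - (u - v)).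
    by rewrite opprB addrC -[u - v - w']addrA -opprD subrK.
  exact: idm.
have zE : sq z = sq (V x) + 2 * l * rp (V x) x + l ^+ 2 * sq x.
  by rewrite /z /sq !opE !rpE (rpC x); ring.
have h1 : sq z - 2 * rp z r + sq r <= sq (V x) by rewrite -sqB -Ur.
have h2 : 0 <= 2 * l * rp (V x) x by rewrite mulr_ge0// mulr_ge0// ltW.
(* The weight is chosen so that its product with [sq z] is at most half of [l ^+ 2 * sq x]. *)
have e0 : 0 < l ^+ 2 / (2 * w) by rewrite divr_gt0 ?exprn_gt0// mulr_gt0.
have h3 := AMGM_rp z r e0; have h4 := ler_norm (rp z r).
have h5 : l ^+ 2 / (2 * w) * sq z <= l ^+ 2 / 2 * sq x.
  have -> : l ^+ 2 / 2 * sq x = l ^+ 2 / (2 * w) * (w * sq x).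
    by field; rewrite gt_eqF.
  by rewrite ler_pM2l//; exact: hw.
have h6 := sq_ge0 r.
have h7 : l ^+ 2 / 2 * sq x <= (l ^+ 2 / (2 * w))^-1 * sq r by lra.
rewrite -(ler_pM2l e0) in h7.
rewrite mulVKf ?gt_eqF// in h7; apply: le_trans h7.
rewrite le_eqVlt; apply/orP; left; apply/eqP; field.
by rewrite gt_eqF.
Qed.

(* With [X = c^2 E^2] and [Y = d^2 W E^-2 W], positivity of the block matrix
   [[X, Z], [Z, Y]] forces [Z <= c d W]: the right-hand side is the geometric
   mean of [X] and [Y], characterised by its Riccati equation. *)
Lemma op_le_of_block Z W E F c d : sa Z -> sa W -> sa E -> sa F ->
  F * E = 1 -> E * F = 1 -> 0 < c -> 0 < d -> (forall x, 0 <= rp (W x) x) ->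
  (forall x y, 0 <= c ^+ 2 * rp ((E * E) x) x + 2 * rp (Z x) y +
    d ^+ 2 * rp ((W * F * F * W) y) y) ->
  forall x, rp (Z x) x <= c * d * rp (W x) x.
Proof.
move=> hZ hW hE hF FE EF c0 d0 W0 block.
have FEx x : F (E x) = x by rewrite -opM FE.
have EFx x : E (F x) = x by rewrite -opM EF.
have cd0 : 0 < c * d by rewrite mulr_gt0.
have key x : rp ((F * Z * F) x) x <= rp (((c * d)%:C *: (F * W * F)) x) x.
  move: x; apply: op_le_of_sq_le; try exact: sa_conj.
  - exact/saZ/sa_conj.
  - by move=> x; rewrite !opE rpZl hF; apply: mulr_ge0; [exact: ltW|exact: W0].
  move=> x; rewrite opZ sqZ /= [0 ^+ 2]expr0n addr0.
  (* For the second vector [F x], this first vector minimises the block form. The minimum being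
     nonnegative is the comparison of squares that [op_le_of_sq_le] asks for. *)
  have := block ((- (c ^+ 2)^-1)%:C *: F ((F * Z * F) x)) (F x).
  set u := (F * Z * F) x; set v := (F * W * F) x.
  have E1 : rp ((E * E) (F u)) (F u) = sq u by rewrite opM EFx hE EFx.
  have E2 : rp (Z (F u)) (F x) = sq u by rewrite -hF /sq /u !opE hF hZ hF hF hZ hF.
  have E3 : rp ((W * F * F * W) (F x)) (F x) = sq v.
    by rewrite /sq /v !opE -hF hF hW hF hF hW.
  rewrite !linearZ /= !rpE E1 E2 E3 => h.
  have c2 : 0 < c ^+ 2 by rewrite exprn_gt0.
  rewrite -(pmulr_rge0 _ c2) in h.
  have EE : c ^+ 2 * (c ^+ 2 * (- (c ^+ 2)^-1 * (- (c ^+ 2)^-1 * sq u)) +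
    2 * (- (c ^+ 2)^-1 * sq u) + d ^+ 2 * sq v) = (c * d) ^+ 2 * sq v - sq u.
    by field; rewrite gt_eqF.
  by rewrite EE subr_ge0 in h.
move=> x; have := key (E x).
by rewrite !opE rpZl !hF FEx.
Qed.

Lemma op_pos_conj A C : op_pos A -> op_pos C -> op_pos (C * A * C).
Proof.
move=> [a [b [a0 [hA aA Ab]]]] hC; have sC := op_pos_sa hC.
have [c c0 hc] := op_invertible_bounded_below (op_pos_invertible hC).
have [d d0 hd] := op_sq_bounded C.
exists (a * c), (`|b| * d); split; first exact: mulr_gt0.
split=> [|x|x]; first exact: sa_conj.
  rewrite !opE sC; apply: le_trans (aA _); rewrite -mulrA.
  by rewrite ler_pM2l.
rewrite !opE sC; apply: le_trans (Ab _) _.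
apply: (@le_trans _ _ (`|b| * sq (C x))).
  by rewrite ler_wpM2r ?sq_ge0// ler_norm.
by rewrite -mulrA ler_wpM2l.
Qed.

(** The polynomial [(u - a) * (b - u)] is nonnegative on [[a, b]], hence so is its value at [A]. *)
Lemma op_between_kantorovich a b A : op_between a A b -> forall x,
  sq (A x) + a * b * sq x <= (a + b) * rp (A x) x.
Proof.
move=> [hA aA Ab] x.
have := @op_poly_ge0 _ _ ((a + b)%:P * 'X - 'X * 'X - (a * b)%:P) A hA _ x.
rewrite !op_polyB !op_polyM !op_polyC !op_polyX !opE !rpE (hA (A x) x) -!/(sq _) => h.
rewrite -subr_ge0; apply: le_trans (h _) _ => [u|]; last lra.
rewrite !hornerE /= => pu; apply: (bounded_below_outside hA aA Ab).
rewrite !ltNge -negb_and; apply/negP => /andP[au ub].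
have : 0 <= (u - a) * (b - u) by rewrite mulr_ge0 ?subr_ge0.
lra.
Qed.

End OrderLemmas.

(** * Positive linear maps and Kadison's inequality *)

Section PositiveMaps.
Variables (R : realType) (H K : hilbertType R).
Variable Phi : {linear bounded_op H -> bounded_op K}.
Hypothesis Phi_pos : positive_map Phi.
Implicit Types (x y : K) (a b c d e : R) (A B C E F T U V W X Y Z : bounded_op H).

Lemma positive_map_psd A x : sa A -> (forall z, 0 <= rp (A z) z) ->
  0 <= rp (Phi A x) x.
Proof.
by move=> hA A0; have /op_psdP[_] : op_psd (Phi A) by apply/Phi_pos/op_psdP.
Qed.

(** A self-adjoint operator is the difference of the positive operators [A + (1 + c)] and
    [1 + c]. *)
Lemma positive_map_sa A : sa A -> sa (Phi A).
Proof.
move=> hA; have [c c0 hc] := op_sq_bounded A.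
have psd1 : op_psd (op_scalar (1 + c) : bounded_op H).
  apply/op_psdP; split=> [|x]; first exact: sa_scalar.
  by rewrite !opE rpZl mulr_ge0 ?sq_ge0//; lra.
have psd2 : op_psd (A + op_scalar (1 + c)).
  apply/op_psdP; split=> [|x]; first exact/saD/sa_scalar.
  rewrite !opE !rpE -/(sq x); have := AMGM_rp (A x) x ltr01; rewrite invr1.
  have := hc x; have := ler_norm (- rp (A x) x); rewrite normrN.
  have := normr_ge0 (rp (A x) x); have := sq_ge0 x; lra.
rewrite -(addrK (op_scalar (1 + c)) A) linearB.
have /op_psdP[h1 _] := Phi_pos psd1; have /op_psdP[h2 _] := Phi_pos psd2.
exact: saB.
Qed.

Lemma positive_map_le A B x : sa A -> sa B ->
  (forall z, rp (A z) z <= rp (B z) z) -> rp (Phi A x) x <= rp (Phi B x) x.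
Proof.
move=> hA hB AB; have := @positive_map_psd (B - A) x (saB hB hA) _.
rewrite linearB !opE !rpE subr_ge0; apply=> z.
by rewrite !opE !rpE subr_ge0.
Qed.

(* Kadison's inequality in block form. The Bernstein polynomials exhibit
   [[1, V], [V, V^2]] as a limit of sums of scalar positive matrices
   [[1, k/n], [k/n, (k/n)^2]] tensored with positive functions of [V]. *)
Lemma positive_map_block C V x y : sa C -> op_pos V ->
  0 <= rp (Phi (C * C) x) x + 2 * rp (Phi (C * V * C) x) y +
    rp (Phi (C * V * V * C) y) y.
Proof.
move=> hC [a [b' [a0 [hV aV Vb']]]].
(* On the zero space [b'] may be negative; the maximum keeps [b] positive, as the division in [q]
   requires. *)
pose b := Num.max b' 1; have b0 : 0 < b by rewrite lt_max ltr01 orbT.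
have Vb z : rp (V z) z <= b * sq z.
  by apply: le_trans (Vb' z) _; rewrite ler_wpM2r ?sq_ge0// le_max lexx.
have V0 z : 0 * sq z <= rp (V z) z.
  by rewrite mul0r; apply: le_trans (aV z); rewrite mulr_ge0 ?sq_ge0// ltW.
(* [q] rescales [[0, b]] to the unit interval of the Bernstein polynomials, and [L u v] is the
   functional, linear in [p], that yields the block entries. *)
pose q : {poly R} := (b^-1)%:P * 'X.
pose L u v (p : {poly R}) := rp (Phi (C * op_poly p V * C) u) v.
have LD u v p r : L u v (p + r) = L u v p + L u v r.
  by rewrite /L op_polyD mulrDr mulrDl linearD opD rpDl.
have LZ u v c p : L u v (c%:P * p) = c * L u v p.
  by rewrite /L mul_polyC op_polyZ op_scalerAr op_scalerAl linearZ opZ rpZl.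
have Lsum u v n f : L u v (bern_sum n f \Po q) =
    \sum_(k < n.+1) f k * L u v (bern R n k \Po q).
  rewrite /bern_sum (raddf_sum (comp_poly q)) /=.
  under [RHS]eq_bigr do rewrite -LZ.
  elim/big_rec2: _ => [|k s t _ IH].
    by rewrite -[0](mul0r 0) -polyC0 LZ mul0r.
  by rewrite LD IH comp_polyM comp_polyC.
have psd n k z : 0 <= L z z (bern R n k \Po q).
  apply: positive_map_psd => [|w]; first by apply: sa_conj => //; exact: sa_op_poly.
  rewrite !opE hC; apply: op_poly_ge0 => // u; rewrite horner_comp /q !hornerE /= => qu.
  apply: (bounded_below_outside hV V0 Vb).
  rewrite !ltNge -negb_and; apply: contraTN qu => /andP[u0 ub].
  rewrite -leNgt; apply: bern_ge0.
  by rewrite mulr_ge0 ?invr_ge0 ?(ltW b0)//= ler_pdivrMl// mulr1.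
(* Bernstein sums reproduce 1 and ['X] exactly, but their second moment exceeds ['X * 'X] by
   [b 'X - 'X * 'X] divided by [n + 1]. This excess is the last term and vanishes in the limit. *)
have main n : 0 <= L x x 1 + 2 * L x y 'X + L y y ('X * 'X) +
    harm R n * L y y (b%:P * 'X - 'X * 'X).
  have [N NE] : exists N : R, n.+1%:R = N by exists n.+1%:R.
  have N0 : N != 0 by rewrite -NE pnatr_eq0.
  have e0 : (bern_sum n.+1 (fun=> 1) \Po q) = 1 by rewrite bern_sum1 comp_polyC.
  have e1 : (bern_sum n.+1 (fun k => b / N * k%:R) \Po q) = 'X.
    rewrite bern_sumZ bern_sumX NE !comp_polyM !comp_polyC comp_polyX /q !mulrA -!polyCM.
    by rewrite (_ : b / N * N / b = 1) ?mul1r//; field; rewrite N0 gt_eqF.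
  have e2 : (bern_sum n.+1 (fun k => (b / N) ^+ 2 * k%:R ^+ 2) \Po q) =
      'X * 'X + (N^-1)%:P * (b%:P * 'X - 'X * 'X).
    rewrite bern_sumZ bern_sumXX NE [in 'X ^+ 2]expr2.
    rewrite comp_polyM comp_polyD !comp_polyM !comp_polyC comp_polyX /q.
    transitivity (((b / N) ^+ 2 * (N * (N - 1)) * b^-1 ^+ 2)%:P * ('X * 'X) +
        ((b / N) ^+ 2 * N / b)%:P * 'X : {poly R}).
      by rewrite ![(_ * b^-1 ^+ 2)%:P]polyCM ![(_ / b)%:P]polyCM polyC_exp !polyCM; ring.
    rewrite (_ : _ * b^-1 ^+ 2 = 1 - N^-1); last by field; rewrite N0 gt_eqF.
    rewrite (_ : _ * N / b = N^-1 * b); last by field; rewrite N0 gt_eqF.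
    by rewrite polyCB polyCM; ring.
  have -> : L x x 1 + 2 * L x y 'X + L y y ('X * 'X) +
      harm R n * L y y (b%:P * 'X - 'X * 'X) =
    \sum_(k < n.+2) L (x + (b / N * k%:R)%:C *: y) (x + (b / N * k%:R)%:C *: y)
       (bern R n.+1 k \Po q).
    rewrite -(LZ y y (harm R n)) -addrA -LD /harm NE -e2 -{1}e0 -{1}e1 !Lsum.
    rewrite mulr_sumr -!big_split /=.
    apply: eq_bigr => k _; rewrite /L linearD linearZ /= !rpE.
    set T := Phi _.
    have hT : sa T by apply/positive_map_sa/sa_conj/hC/sa_op_poly.
    rewrite (hT y x) (rpC y); ring.
  by apply: sumr_ge0 => k _; exact: psd.
have -> : rp (Phi (C * C) x) x + 2 * rp (Phi (C * V * C) x) y +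
    rp (Phi (C * V * V * C) y) y = L x x 1 + 2 * L x y 'X + L y y ('X * 'X).
  by rewrite /L op_poly1 op_polyX op_polyM op_polyX mulr1 !mulrA.
rewrite leNgt; apply/negP => neg.
set s := L x x 1 + _ + _ in main neg; set g := L y y (_ - _) in main.
have g1 : 0 <= `|g| + 1 by rewrite addr_ge0.
have s0 : 0 < - s by rewrite oppr_gt0.
have [n hn] := harmonic_small g1 s0.
have := main n; have := ler_norm g => hg.
have : harm R n * g <= harm R n * (`|g| + 1).
  by rewrite ler_pM2l ?harmonic_gt0//; lra.
lra.
Qed.

End PositiveMaps.

(** * The main inequality *)

(** Bisection keeps [t] between two points of [D] at distance [2^-n]. *)
Lemma midpoint_dense (R : realType) (D : R -> Prop) : D 0 -> D 1 ->
  (forall s r, 0 <= s <= 1 -> 0 <= r <= 1 -> D s -> D r -> D ((s + r) / 2)) ->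
  forall t e, 0 <= t <= 1 -> 0 < e -> exists2 s, D s & (0 <= s <= 1) && (`|s - t| < e).
Proof.
move=> D0 D1 Dm t e t01 e0.
have dyadic n : exists s r, [/\ D s, D r, 0 <= s <= t, t <= r <= 1 & r - s = 2^-1 ^+ n].
  elim: n => [|n [s [r [Ds Dr /andP[s0 st] /andP[tr r1] sr]]]].
    by exists 0, 1; rewrite subr0 expr0; move/andP: t01 => [t0 t1]; split; rewrite ?lexx ?t0 ?t1.
  have Dsr : D ((s + r) / 2) by apply: Dm => //; apply/andP; split; lra.
  have [mt|/ltW tm] := leP ((s + r) / 2) t.
    exists ((s + r) / 2), r; split=> //; last by rewrite exprS -sr; lra.
      by apply/andP; split; lra.
    by rewrite tr.
  exists s, ((s + r) / 2); split=> //; last by rewrite exprS -sr; lra.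
    by rewrite s0.
  by apply/andP; split; lra.
have [n hn] := @harmonic_small R 1 e ler01 e0.
have [s [r [Ds _ /andP[s0 st] /andP[tr r1] sr]]] := dyadic n.
exists s => //; rewrite s0 (le_trans st)/=; last by case/andP: t01.
have : 2^-1 ^+ n <= harm R n.
  by rewrite exprVn lef_pV2 ?posrE ?exprn_gt0// -natrX ler_nat ltn_expl.
rewrite mulr1 in hn => h; rewrite ltr_norml; apply/andP; split; lra.
Qed.

(** * The geometric mean of an inverse with a positive operator *)

Section InverseGeometricMean.
Variables (R : realType) (H : hilbertType R).
Implicit Types (A B C V : bounded_op H).

Let half2 : 2^-1 + 2^-1 = 1 :> R. Proof. by field. Qed.

Lemma op_powR_half A : op_pos A -> op_powR A 2^-1 * op_powR A 2^-1 = A.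
Proof. by move=> hA; rewrite -op_powRD// half2 op_powR1. Qed.

Lemma op_powR_Nhalf A :
  op_pos A -> op_powR A (- 2^-1) * op_powR A (- 2^-1) = op_inv A.
Proof. by move=> hA; rewrite -op_powRD// -opprD half2 op_inv_powR. Qed.

Lemma op_powRVK A s : op_pos A -> op_powR A (- s) * op_powR A s = 1.
Proof. by move=> hA; rewrite -op_powRD// addNr op_powR0. Qed.

Lemma op_powRKV A s : op_pos A -> op_powR A s * op_powR A (- s) = 1.
Proof. by move=> hA; rewrite -op_powRD// subrr op_powR0. Qed.

Lemma op_inv_pos A : op_pos A -> op_pos (op_inv A).
Proof. by move=> hA; rewrite op_inv_powR//; exact: op_powR_pos. Qed.

Lemma op_mulKV A : op_pos A -> A * op_inv A = 1.
Proof. by move=> hA; rewrite op_inv_powR// -{1}(op_powR1 hA) op_powRKV. Qed.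

(* [C = A^(-1/2)] and [V] is the square root of [C^-1 B C^-1]. *)
Lemma geometric_mean_factor A B : op_pos A -> op_pos B -> exists C V,
  [/\ op_pos C, op_pos V, C * C = op_inv A,
      C * V * C = geometric_mean (op_inv A) B & C * V * V * C = B].
Proof.
move=> hA hB; have hAi := op_inv_pos hA.
set C := op_powR (op_inv A) 2^-1; set C' := op_powR (op_inv A) (- 2^-1).
have hC : op_pos C by exact: op_powR_pos.
have hC' : op_pos C' by exact: op_powR_pos.
have hV := op_pos_conj hB hC'.
exists C, (op_powR (C' * B * C') 2^-1); split=> //.
- exact: op_powR_pos.
- exact: op_powR_half.
by rewrite -[C * _ * _]mulrA op_powR_half// !mulrA op_powRKV// mul1r -mulrA op_powRVK// mulr1.
Qed.

Lemma geometric_mean_pos A B :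
  op_pos A -> op_pos B -> op_pos (geometric_mean (op_inv A) B).
Proof.
move=> hA hB; have [C [V [hC hV _ <- _]]] := geometric_mean_factor hA hB.
exact: op_pos_conj.
Qed.

(** In [(C V C) A (C V C)] the middle factor [C A C] collapses to 1 because [C * C] is the inverse
    of [A]. *)
Lemma geometric_mean_riccati A B : op_pos A -> op_pos B ->
  geometric_mean (op_inv A) B * A * geometric_mean (op_inv A) B = B.
Proof.
move=> hA hB; have [C [V [hC _ CC <- CVVC]]] := geometric_mean_factor hA hB.
have CAC : C * A * C = 1.
  have AC : A * C * C = 1 by rewrite -mulrA CC op_mulKV.
  have [C' [C'C CC']] := op_pos_invertible hC.
  rewrite -[C * A * C]mulr1 -CC' !mulrA -[C * A * C * C]mulrA.
  by rewrite -[C * A * _]mulrA [A * (C * C)]mulrA AC mulr1.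
rewrite -[RHS]CVVC -!mulrA; congr (_ * (_ * _)).
by rewrite !mulrA CAC mul1r.
Qed.

(** The Riccati equation gives [rp (A (G x)) (G x) = rp (B x) x], so the bounds on [A] and [B] put
    [sq (G x)] between [m / M] and [M / m] times [sq x]. Then [op_le_of_sq_le] extracts the square
    roots. *)
Lemma geometric_mean_between A B m M : 0 < m -> m <= M ->
  op_between m A M -> op_between m B M ->
  op_between ((m / M) `^ 2^-1) (geometric_mean (op_inv A) B) ((m / M) `^ (- 2^-1)).
Proof.
move=> m0 mM hA hB; have M0 : 0 < M by apply: lt_le_trans mM.
have pA : op_pos A by exists m, M.
have pB : op_pos B by exists m, M.
have [_ mA AM] := hA; have [_ mB BM] := hB.
set G := geometric_mean _ _; have pG : op_pos G by exact: geometric_mean_pos.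
have sG := op_pos_sa pG.
have GAG x : rp (A (G x)) (G x) = rp (B x) x.
  by rewrite -sG -(opM A) -(opM G) [G * (A * G)]mulrA geometric_mean_riccati.
set g := (m / M) `^ 2^-1; have g0 : 0 < g by rewrite powR_gt0// divr_gt0.
have gg : g ^+ 2 = m / M.
  by rewrite expr2 -powRD ?half2 ?powRr1 ?oner_eq0// ?divr_ge0 ?ltW.
have scal c : sa (op_scalar c : bounded_op H) by exact: sa_scalar.
have scalE c x : rp (op_scalar c x : H) x = c * sq x by rewrite op_scalarE rpZl.
have scalS c x : sq (op_scalar c x : H) = c ^+ 2 * sq x.
  by rewrite op_scalarE sqZ /= [0 ^+ 2]expr0n addr0.
rewrite powRN -/g; split=> // x; rewrite -scalE; move: x.
  apply: op_le_of_sq_le => // [x|x]; first exact: op_pos_ge0.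
  rewrite scalS gg mulrAC ler_pdivrMr// mulrC [leRHS]mulrC.
  have := AM (G x); rewrite GAG; apply: le_trans.
  by rewrite mulrC; exact: mB.
apply: op_le_of_sq_le => // [x|x].
  by rewrite scalE mulr_ge0 ?sq_ge0// invr_ge0 ltW.
rewrite scalS exprVn gg invf_div mulrAC ler_pdivlMr// mulrC.
by apply: le_trans (mA (G x)) _; rewrite GAG.
Qed.

End InverseGeometricMean.

(** * Positive unital maps and the spectral geometric mean *)

Section MainInequality.
Variables (R : realType) (H K : hilbertType R).
Variable Phi : {linear bounded_op H -> bounded_op K}.
Hypotheses (Phi_pos : positive_map Phi) (Phi_unital : unital_map Phi).
Variables (A B : bounded_op H) (m M t : R).
Hypotheses (m_gt0 : 0 < m) (mM : m <= M).
Hypotheses (A_between : op_between m A M) (B_between : op_between m B M).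
Hypothesis t01 : 0 <= t <= 1.
Implicit Types (x y z : K).

Let M_gt0 : 0 < M. Proof. exact: lt_le_trans m_gt0 mM. Qed.

Let A_pos : op_pos A. Proof. by exists m, M. Qed.
Let B_pos : op_pos B. Proof. by exists m, M. Qed.

Lemma unital_map_between X : op_between m X M -> op_between m (Phi X) M.
Proof.
move=> [sX mX XM]; have scal c : sa (op_scalar c : bounded_op H) by exact: sa_scalar.
have scalE c (z : H) : rp (op_scalar c z) z = c * sq z by rewrite op_scalarE rpZl.
have PhiE c z : rp (Phi (op_scalar c) z) z = c * sq z.
  by rewrite linearZ /= Phi_unital rpZl.
split=> [|x|x]; first exact: positive_map_sa.
  rewrite -PhiE; apply: positive_map_le => // z; first by rewrite scalE.
by rewrite -PhiE; apply: positive_map_le => // z; first by rewrite scalE.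
Qed.

Let PA_pos : op_pos (Phi A). Proof. by exists m, M; split=> //; exact: unital_map_between. Qed.
Let PB_pos : op_pos (Phi B). Proof. by exists m, M; split=> //; exact: unital_map_between. Qed.

Let G := geometric_mean (op_inv A) B.
Let L := geometric_mean (op_inv (Phi A)) (Phi B).
Let G_pos : op_pos G. Proof. exact: geometric_mean_pos. Qed.
Let L_pos : op_pos L. Proof. exact: geometric_mean_pos. Qed.

(** The Kantorovich constant [K(h)] at [h = M / m]. *)
Let kappa : R := (M + m) ^+ 2 / (4 * (M * m)).
Let kappa_gt0 : 0 < kappa.
Proof. by rewrite divr_gt0 ?exprn_gt0 ?addr_gt0 ?mulr_gt0. Qed.

(** Kantorovich's inequality: apply [Phi] to [M m A^-1 + A <= M + m], then eliminate [Phi A] by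
    completing a square with [Phi(A)^(1/2) x] and [(M + m) / 2] times [Phi(A)^(-1/2) x]. *)
Lemma positive_map_inv_le x :
  rp (Phi (op_inv A) x) x <= kappa * rp (op_inv (Phi A) x) x.
Proof.
have h1 : rp (Phi ((M * m)%:C *: op_inv A + A) x) x <=
    rp (Phi (op_scalar (M + m)) x) x.
  have sAi := op_pos_sa (op_inv_pos A_pos); have sA := op_pos_sa A_pos.
  apply: positive_map_le => // [||z]; [by apply/saD/sA/saZ|exact: sa_scalar|].
  set D := op_powR A (- 2^-1).
  have sD : sa D by exact/op_pos_sa/op_powR_pos.
  have DD : D * D = op_inv A by exact: op_powR_Nhalf.
  have AD : A * D = op_powR A 2^-1.
    by rewrite -[X in X * _](op_powR1 A_pos) -op_powRD//; congr op_powR; field.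
  have := op_between_kantorovich A_between (D z).
  rewrite -!(opM A D) AD -DD !opE !rpE.
  have E1 : rp (A z) z = sq (op_powR A 2^-1 z).
    rewrite -{1}(op_powR_half A_pos) opM; apply: (op_pos_sa (op_powR_pos _ A_pos)).
  have E2 : rp (op_powR A 2^-1 z) (D z) = sq z.
    by rewrite -sD -opM op_powRVK.
  by rewrite E1 E2 sD /sq; lra.
rewrite linearD !linearZ /= Phi_unital !rpE in h1.
pose D := op_powR (Phi A) (- 2^-1); pose F := op_powR (Phi A) 2^-1.
have sD : sa D by exact/op_pos_sa/op_powR_pos.
have sF : sa F by exact/op_pos_sa/op_powR_pos.
rewrite -(op_powR_Nhalf PA_pos) -/D opM sD.
have E1 : rp (Phi A x) x = sq (F x) by rewrite -{1}(op_powR_half PA_pos) opM sF.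
have E2 : rp (F x) (D x) = sq x by rewrite -sD -opM op_powRVK.
have := sq_ge0 (F x - ((M + m) / 2)%:C *: D x).
rewrite sqB rpZr E2 sqZ /= -E1 => h2.
have Mm0 : 0 < M * m by rewrite mulr_gt0.
rewrite -(ler_pM2l Mm0) mulrA.
have -> : M * m * kappa = ((M + m) / 2) ^+ 2.
  by rewrite /kappa; field; rewrite gt_eqF// gt_eqF.
rewrite /sq in h1 h2 *; lra.
Qed.

(** The block inequality with [C = A^(-1/2)] and [V = A] has entries [Phi(A^-1)], 1 and [Phi(A)];
    test it at [y = - Phi(A)^-1 x]. *)
Lemma inv_le_positive_map x : rp (op_inv (Phi A) x) x <= rp (Phi (op_inv A) x) x.
Proof.
pose D := op_powR A (- 2^-1).
have sD : sa D by exact/op_pos_sa/op_powR_pos.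
have AD : A * D = op_powR A 2^-1.
  by rewrite -[X in X * _](op_powR1 A_pos) -op_powRD//; congr op_powR; field.
have DA : D * A = op_powR A 2^-1.
  by rewrite -[X in _ * X](op_powR1 A_pos) -op_powRD//; congr op_powR; field.
have := positive_map_block Phi_pos x (- op_inv (Phi A) x) sD A_pos.
rewrite op_powR_Nhalf// DA op_powRKV// -mulrA AD op_powR_half// Phi_unital.
rewrite linearN /= !rpE -(opM (Phi A)) op_mulKV// !op1 (rpC x); lra.
Qed.

(** The block with entries [Phi(A^-1)], [Phi(G)], [Phi(B)] is positive. Its first entry is at most
    [kappa] times [Phi(A)^-1], and its last is [L Phi(A) L] by Riccati, so [op_le_of_block] applies
    with [c = kappa^(1/2)] and [d = 1]. *)
Lemma positive_map_geometric_mean x : rp (Phi G x) x <= kappa `^ 2^-1 * rp (L x) x.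
Proof.
have [C [V [hC hV CC CVC CVVC]]] := geometric_mean_factor A_pos B_pos.
pose D := op_powR (Phi A) (- 2^-1); pose F := op_powR (Phi A) 2^-1.
have sD : sa D by exact/op_pos_sa/op_powR_pos.
have sF : sa F by exact/op_pos_sa/op_powR_pos.
have k0 : 0 < kappa `^ 2^-1 by exact: powR_gt0.
rewrite -[kappa `^ _]mulr1.
apply: (@op_le_of_block _ _ _ _ D F) => //.
- exact/positive_map_sa/op_pos_sa.
- exact: op_pos_sa.
- exact: op_powRKV.
- exact: op_powRVK.
- by move=> y; exact: op_pos_ge0.
move=> y z; have := positive_map_block Phi_pos y z (op_pos_sa hC) hV.
rewrite CC CVC CVVC -/G -[L * F * F]mulrA op_powR_half// geometric_mean_riccati//.
rewrite op_powR_Nhalf// expr1n mul1r expr2 -powRD; last first.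
  by apply/implyP => _; rewrite gt_eqF.
rewrite (_ : 2^-1 + 2^-1 = 1) ?powRr1 ?(ltW kappa_gt0)//; last by field.
by have := positive_map_inv_le y; lra.
Qed.

(** With [C = G^(s/2)] and [V = G^((r-s)/2)] the block has entries [Phi] of [G^s], [G^((s+r)/2)] and
    [G^r]. The two hypotheses bound its diagonal, and [op_le_of_block] is used with
    [c = kappa^(s/4)], [d = kappa^(r/4)]. *)
Lemma positive_map_powR_midpoint s r :
  (forall x, rp (Phi (op_powR G s) x) x <= kappa `^ (s / 2) * rp (op_powR L s x) x) ->
  (forall x, rp (Phi (op_powR G r) x) x <= kappa `^ (r / 2) * rp (op_powR L r x) x) ->
  forall x, rp (Phi (op_powR G ((s + r) / 2)) x) x <=
    kappa `^ ((s + r) / 2 / 2) * rp (op_powR L ((s + r) / 2) x) x.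
Proof.
move=> hs hr x.
have kD u v : kappa `^ (u + v) = kappa `^ u * kappa `^ v.
  by rewrite powRD//; apply/implyP => _; rewrite gt_eqF.
have sq_k u : (kappa `^ (u / 4)) ^+ 2 = kappa `^ (u / 2).
  by rewrite expr2 -kD; congr powR; field.
have -> : kappa `^ ((s + r) / 2 / 2) = kappa `^ (s / 4) * kappa `^ (r / 4).
  by rewrite -kD; congr powR; field.
have pL u : op_pos (op_powR L u) by exact: op_powR_pos.
have pG u : op_pos (op_powR G u) by exact: op_powR_pos.
apply: (@op_le_of_block _ _ _ _ (op_powR L (s / 2)) (op_powR L (- (s / 2)))) => //.
- exact/positive_map_sa/op_pos_sa.
- exact: op_pos_sa.
- exact: op_pos_sa.
- exact: op_pos_sa.
- exact: op_powRVK.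
- exact: op_powRKV.
- exact: powR_gt0.
- exact: powR_gt0.
- by move=> y; exact: op_pos_ge0.
move=> y z; have := positive_map_block Phi_pos y z
  (op_pos_sa (pG (s / 2))) (pG ((r - s) / 2)).
rewrite -!op_powRD// !sq_k.
rewrite (_ : s / 2 + s / 2 = s); last by field.
rewrite (_ : s / 2 + (r - s) / 2 + s / 2 = (s + r) / 2); last by field.
rewrite (_ : s / 2 + (r - s) / 2 + (r - s) / 2 + s / 2 = r); last by field.
rewrite (_ : (s + r) / 2 - s / 2 - s / 2 + (s + r) / 2 = r); last by field.
by have := hs y; have := hr z; lra.
Qed.

Lemma positive_map_powR x :
  rp (Phi (op_powR G t) x) x <= kappa `^ (t / 2) * rp (op_powR L t x) x.
Proof.
pose D s := forall x, rp (Phi (op_powR G s) x) x <= kappa `^ (s / 2) * rp (op_powR L s x) x.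
have D0 : D 0.
  by move=> y; rewrite !op_powR0// Phi_unital mul0r powRr0 mul1r.
have D1 : D 1.
  by move=> y; rewrite !op_powR1// mul1r; exact: positive_map_geometric_mean.
have Dm s r : 0 <= s <= 1 -> 0 <= r <= 1 -> D s -> D r -> D ((s + r) / 2).
  by move=> _ _; exact: positive_map_powR_midpoint.
have [c c0 hc] := op_powR_continuous G_pos.
have [d d0 hd] := op_powR_continuous L_pos.
have [w w0 hw] : exists2 w, 0 < w & forall s r, 0 <= s <= 1 -> 0 <= r <= 1 ->
    `|kappa `^ (s / 2) - kappa `^ (r / 2)| <= w * `|s - r|.
  exists (expR (ln_bound kappa kappa) * ln_bound kappa kappa + 1).
    by rewrite ltr_wpDl// mulr_ge0 ?expR_ge0// ln_bound_ge0.
  move=> s r s01 r01.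
  apply: le_trans (@powR_exponent_lipschitz _ kappa kappa _ _ _ kappa_gt0 _ _ _) _.
  - by rewrite lexx.
  - by apply/andP; split; lra.
  - by apply/andP; split; lra.
  rewrite -mulrBl normrM (ger0_norm (_ : 0 <= 2^-1 :> R)) ?invr_ge0//.
  have W0 : 0 <= expR (ln_bound kappa kappa) * ln_bound kappa kappa.
    by rewrite mulr_ge0 ?expR_ge0// ln_bound_ge0.
  have n0 := normr_ge0 (s - r); have := mulr_ge0 W0 n0; lra.
apply/ler_addgt0Pr => e e0.
set q := sq x; have q0 : 0 <= q by exact: sq_ge0.
set lt := rp (op_powR L t x) x; set kt := kappa `^ (t / 2).
have kt0 : 0 <= kt by exact: powR_ge0.
(* [Z] collects the coefficients of [|s - t|] in the three errors: from [L^s], from [kappa^(s/2)]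
   and from [G^s]. *)
pose Z := kt * d * q + w * (`|lt| + d * q) + c * q.
have Z0 : 0 <= Z.
  by rewrite !addr_ge0 ?mulr_ge0 ?addr_ge0 ?mulr_ge0 ?(ltW d0) ?(ltW w0) ?(ltW c0).
have Z1 : 0 < Z + 1 by lra.
have e1 : 0 < Num.min 1 (e / (Z + 1)) by rewrite lt_min ltr01 divr_gt0.
have [s Ds /andP[s01 st]] := midpoint_dense D0 D1 Dm t01 e1.
move: st; rewrite lt_min => /andP[/ltW st1]; rewrite ltr_pdivlMr// => stZ.
have := hw _ _ s01 t01; have := hd _ _ x s01 t01; have := hc _ _ _ s01 t01.
move: (Ds x) (normr_ge0 (s - t)) st1 stZ; move: `|s - t| => del.
rewrite -/lt -/kt -/q; set ls := rp (op_powR L s x) x; set ks := kappa `^ (s / 2).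
move=> gs del0 del1 delZ hcs hds hws.
have gts : rp (Phi (op_powR G t) x) x <= rp (Phi (op_powR G s) x) x + c * del * q.
  have -> : rp (Phi (op_powR G s) x) x + c * del * q =
      rp (Phi (op_powR G s + op_scalar (c * del)) x) x.
    by rewrite linearD linearZ /= Phi_unital rpDl rpZl.
  have sG u : sa (op_powR G u) by exact/op_pos_sa/op_powR_pos.
  apply: positive_map_le => // [|z]; first exact/saD/sa_scalar.
  rewrite !opE rpDl rpZl -/(sq z); have := hcs z.
  by rewrite ler_norml => /andP[h _]; lra.
apply: le_trans gts _; apply: le_trans (lerD gs (lexx _)) _.
have l1 : `|ls| <= `|lt| + d * q.
  have := ler_normD (ls - lt) lt; rewrite subrK.
  have : d * del * q <= d * 1 * q by rewrite ler_wpM2r// ler_pM2l.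
  lra.
have k1 : (ks - kt) * ls <= w * del * (`|lt| + d * q).
  apply: le_trans (ler_norm _) _; rewrite normrM; exact: ler_pM.
have k2 : kt * (ls - lt) <= kt * (d * del * q).
  by rewrite ler_wpM2l//; apply: le_trans (ler_norm _) hds.
rewrite /Z in delZ; lra.
Qed.

(** The operator [G^t] lies between [sigma] and [sigma^-1]. *)
Let sigma : R := (m / M) `^ (t / 2).
Let mM_gt0 : 0 < m / M. Proof. exact: divr_gt0. Qed.
Let sigma_gt0 : 0 < sigma. Proof. exact: powR_gt0. Qed.
Let t_ge0 : 0 <= t. Proof. by case/andP: t01. Qed.

(** [op_between_kantorovich] for [A^(1/2) G^t A^(1/2)], which lies between [m * sigma] and
    [M / sigma], tested at [A^(-1/2) z]. *)
Lemma spectral_geometric_mean_reverse (z : H) :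
  rp (spectral_geometric_mean t A B z) z + m * M * rp (op_inv A z) z <=
    (m * sigma + M / sigma) * rp (op_powR G t z) z.
Proof.
have hG : op_between sigma (op_powR G t) sigma^-1.
  have := geometric_mean_between m_gt0 mM A_between B_between.
  move/(op_powR_between (powR_gt0 _ mM_gt0) t_ge0); rewrite -!powRrM mulNr powRN.
  by rewrite [2^-1 * t]mulrC.
have [sG Gge Gle] := hG.
pose E := op_powR A 2^-1; pose D := op_powR A (- 2^-1).
have sE : sa E by exact/op_pos_sa/op_powR_pos.
have sD : sa D by exact/op_pos_sa/op_powR_pos.
have EEz (x : H) : sq (E x) = rp (A x) x by rewrite /sq sE rpC -opM op_powR_half.
have EDx (x : H) : E (D x) = x by rewrite -opM op_powRKV.
have [_ mA AM] := A_between.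
have hV : op_between (m * sigma) (E * op_powR G t * E) (M / sigma).
  split=> [|x|x]; first exact: sa_conj.
    rewrite !opE sE; apply: le_trans (Gge _).
    by rewrite EEz mulrAC [leLHS]mulrC ler_pM2l.
  rewrite !opE sE; apply: le_trans (Gle _) _.
  by rewrite EEz mulrAC [leRHS]mulrC ler_pM2l ?invr_gt0.
have := op_between_kantorovich hV (D z).
have -> : m * sigma * (M / sigma) = m * M by field; rewrite gt_eqF.
rewrite !opM EDx EEz.
have -> : rp (E (op_powR G t z)) (D z) = rp (op_powR G t z) z by rewrite sE EDx.
have -> : sq (D z) = rp (op_inv A z) z by rewrite /sq sD rpC -opM op_powR_Nhalf.
have -> : rp (spectral_geometric_mean t A B z) z =
    rp (A (op_powR G t z)) (op_powR G t z) by rewrite -sG.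
by [].
Qed.

Lemma positive_map_spectral_geometric_mean x :
  rp (Phi (spectral_geometric_mean t A B) x) x <=
  (m * sigma + M / sigma) ^+ 2 * kappa `^ t / (4 * (m * M)) *
    rp (spectral_geometric_mean t (Phi A) (Phi B) x) x.
Proof.
have pGt : op_pos (op_powR G t) by exact: op_powR_pos.
have pLt : op_pos (op_powR L t) by exact: op_powR_pos.
have sAi := op_pos_sa (op_inv_pos A_pos).
have sS : sa (spectral_geometric_mean t A B) by exact/sa_conj/op_pos_sa/pGt/op_pos_sa.
have h1 : rp (Phi (spectral_geometric_mean t A B + (m * M)%:C *: op_inv A) x) x <=
    rp (Phi ((m * sigma + M / sigma)%:C *: op_powR G t) x) x.
  apply: positive_map_le => // [||z]; [exact/saD/saZ|exact/saZ/op_pos_sa|].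
  by rewrite !opE !rpE; exact: spectral_geometric_mean_reverse.
rewrite linearD !linearZ /= !rpE in h1.
have a0 : 0 < m * M by exact: mulr_gt0.
have b0 : 0 < m * sigma + M / sigma by rewrite addr_gt0 ?mulr_gt0 ?invr_gt0.
have h2 := positive_map_powR x.
have h3 := inv_le_positive_map x.
set k := kappa `^ (t / 2) in h2; set b := m * sigma + M / sigma in h1 b0 *.
have kk : kappa `^ t = k ^+ 2.
  rewrite /k expr2 -powRD; last by apply/implyP => _; rewrite gt_eqF.
  by congr powR; field.
rewrite kk.
pose D := op_powR (Phi A) (- 2^-1); pose F := op_powR (Phi A) 2^-1.
have sD : sa D by exact/op_pos_sa/op_powR_pos.
have sF : sa F by exact/op_pos_sa/op_powR_pos.
have sL := op_pos_sa pLt.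
set l := op_powR L t in h2 sL.
have E1 : rp (spectral_geometric_mean t (Phi A) (Phi B) x) x = sq (F (l x)).
  rewrite /spectral_geometric_mean -/L -/l !opM sL /sq sF rpC -(opM F).
  by rewrite op_powR_half.
have E2 : sq (D x) = rp (op_inv (Phi A) x) x.
  by rewrite /sq sD rpC -opM op_powR_Nhalf.
have E3 : rp (F (l x)) (D x) = rp (l x) x by rewrite -sD -opM op_powRVK.
(* AM-GM: [4 a b k <l x, x> <= (b k)^2 |F l x|^2 + 4 a^2 |D x|^2], [a = m M] *)
have := sq_ge0 ((b * k)%:C *: F (l x) - (2 * (m * M))%:C *: D x).
rewrite sqB rpZl rpZr !sqZ /= E2 E3 E1 => h4.
have a4 : 0 < 4 * (m * M) by rewrite mulr_gt0.
rewrite mulrAC ler_pdivlMr//.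
have h5 : b * rp (Phi (op_powR G t) x) x <= b * (k * rp (l x) x) by rewrite ler_pM2l.
have h6 : m * M * rp (op_inv (Phi A) x) x <= m * M * rp (Phi (op_inv A) x) x.
  by rewrite ler_pM2l.
set S := rp (Phi (spectral_geometric_mean t A B) x) x in h1 *.
set P := rp (op_inv (Phi A) x) x in h3 h4 h6 *.
have h7 : 4 * (m * M) * S <= 4 * (m * M) * (b * (k * rp (l x) x) - m * M * P).
  by rewrite ler_pM2l//; lra.
move: h4 h7; move: (m * M) => a h4 h7; lra.
Qed.

(** Written in [p = M^t] and [r = m^t], the quotient of the two sides is [q ^+ 2] over
    [4 * (M * p) * (m * r)] with [q = M p + m r]. This is [K(h^(1+t))], at least 1 by the
    arithmetic-geometric inequality. *)
Lemma spectral_geometric_mean_constant_le :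
  (m * sigma + M / sigma) ^+ 2 * kappa `^ t / (4 * (m * M)) <=
  (M + m) `^ (2 * t) * (M `^ (1 + t) + m `^ (1 + t)) ^+ 4 /
    (4 `^ (2 + t) * M `^ (2 + 3 * t) * m `^ (2 + 3 * t)).
Proof.
set p := M `^ t; set r := m `^ t; set w := (M + m) `^ t; set f : R := 4 `^ t.
have p0 : 0 < p by exact: powR_gt0.
have r0 : 0 < r by exact: powR_gt0.
have w0 : 0 < w by apply: powR_gt0; exact: addr_gt0.
have f0 : 0 < f by exact: powR_gt0.
have D1 u : 0 < u -> u `^ (1 + t) = u * u `^ t.
  by move=> u0; rewrite powRD ?powRr1 ?ltW//; apply/implyP => _; rewrite gt_eqF.
have D2 u : 0 < u -> u `^ (2 * t) = (u `^ t) ^+ 2.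
  by move=> u0; rewrite mulrC powRrM powR_mulrn// powR_ge0.
have D3 u : 0 < u -> u `^ (2 + 3 * t) = u ^+ 2 * (u `^ t) ^+ 3.
  move=> u0; rewrite powRD; last by apply/implyP => _; rewrite gt_eqF.
  by rewrite powR_mulrn ?ltW// mulrC [3 * t]mulrC powRrM powR_mulrn ?powR_ge0// mulrC.
have D4 : 4 `^ (2 + t) = 16 * f.
  rewrite powRD; last by apply/implyP => _; rewrite gt_eqF.
  by rewrite powR_mulrn//; congr (_ * _); ring.
rewrite D4 !D1// !D3// D2 ?addr_gt0// -/p -/r -/w.
have DV u : 0 < u -> u^-1 `^ t = (u `^ t)^-1.
  by move=> u0; rewrite -(powR_inv1 (ltW u0)) powRAC powR_inv1 ?powR_ge0.
have s2 : sigma ^+ 2 = r / p.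
  rewrite /sigma -powR_mulrn ?powR_ge0// -powRrM divfK//.
  by rewrite powRM ?invr_ge0 ?(ltW m_gt0) ?(ltW M_gt0)// DV.
have kE : kappa `^ t = w ^+ 2 / (f * (p * r)).
  have Mm0 : 0 < M * m by exact: mulr_gt0.
  have d0 : 0 < 4 * (M * m) by exact: mulr_gt0.
  rewrite /kappa powRM ?invr_ge0 ?(ltW d0) ?sqr_ge0// DV//.
  rewrite -powR_mulrn ?addr_ge0 ?(ltW m_gt0) ?(ltW M_gt0)// powRAC.
  rewrite powR_mulrn ?powR_ge0// powRM ?(ltW Mm0)//.
  by rewrite powRM ?(ltW m_gt0) ?(ltW M_gt0).
have -> : (m * sigma + M / sigma) ^+ 2 = (M * p + m * r) ^+ 2 / (p * r).
  have -> : (m * sigma + M / sigma) ^+ 2 = (m * sigma ^+ 2 + M) ^+ 2 / sigma ^+ 2.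
    by field; rewrite gt_eqF.
  by rewrite s2; field; rewrite !gt_eqF.
rewrite kE.
set q := M * p + m * r.
have q0 : 0 < q by rewrite addr_gt0// mulr_gt0.
have qq : 4 * (M * p) * (m * r) <= q ^+ 2.
  have := sqr_ge0 (M * p - m * r); rewrite /q; lra.
have -> : q ^+ 2 / (p * r) * (w ^+ 2 / (f * (p * r))) / (4 * (m * M)) =
    w ^+ 2 * q ^+ 2 / (16 * f * (M ^+ 2 * p ^+ 3) * (m ^+ 2 * r ^+ 3)) *
    (4 * (M * p) * (m * r)).
  by field; rewrite !gt_eqF.
have -> : w ^+ 2 * q ^+ 4 / (16 * f * (M ^+ 2 * p ^+ 3) * (m ^+ 2 * r ^+ 3)) =
    w ^+ 2 * q ^+ 2 / (16 * f * (M ^+ 2 * p ^+ 3) * (m ^+ 2 * r ^+ 3)) * q ^+ 2.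
  by field; rewrite !gt_eqF.
rewrite ler_wpM2l//.
have den0 : 0 < 16 * f * (M ^+ 2 * p ^+ 3) * (m ^+ 2 * r ^+ 3).
  by rewrite !mulr_gt0 ?exprn_gt0.
by apply: divr_ge0; [rewrite mulr_ge0 ?exprn_ge0 ?(ltW w0) ?(ltW q0)|exact: ltW].
Qed.

Lemma spectral_geometric_mean_psd :
  sa (spectral_geometric_mean t (Phi A) (Phi B)) /\
  forall x, 0 <= rp (spectral_geometric_mean t (Phi A) (Phi B) x) x.
Proof.
have sL : sa (op_powR L t) by exact/op_pos_sa/op_powR_pos.
split; first exact/sa_conj/sL/op_pos_sa.
by move=> x; rewrite /spectral_geometric_mean -/L !opM sL op_pos_ge0.
Qed.

End MainInequality.

Unset Implicit Arguments.
Set Strict Implicit.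

Theorem theorem2p3 (R : realType) (H K : hilbertType R)
    (A B : bounded_op H) (m M : R)
    (Phi : {linear bounded_op H -> bounded_op K}) (t : R)
    (A_posdef : op_posdef A) (B_posdef : op_posdef B) (m_gt0 : 0 < m)
    (mA : op_le (op_scalar m) A) (AM : op_le A (op_scalar M))
    (mB : op_le (op_scalar m) B) (BM : op_le B (op_scalar M))
    (Phi_pos : positive_map Phi) (Phi_unital : unital_map Phi)
    (t_ge0 : 0 <= t) (t_le1 : t <= 1) :
  let beta : R :=
    (M + m) `^ (2 * t) * (M `^ (1 + t) + m `^ (1 + t)) ^+ 4 /
    (4 `^ (2 + t) * M `^ (2 + 3 * t) * m `^ (2 + 3 * t)) in
  op_le (Phi (spectral_geometric_mean t A B))
        (beta%:C *: spectral_geometric_mean t (Phi A) (Phi B)).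
Proof.
move=> beta.
have [/op_leP[sA mA'] /op_leP[_ AM'] /op_leP[sB mB'] /op_leP[_ BM']] :=
  And4 mA AM mB BM.
have rE c (x : H) : rp (op_scalar c x) x = c * sq x by rewrite op_scalarE rpZl.
have A_between : op_between m A M.
  split=> [|x|x]; rewrite -?rE//.
  (* The order relation supplies self-adjointness of [A - m], from which that of [A] is
     recovered. *)
  by rewrite -[A](subrK (op_scalar m)); exact/saD/sa_scalar.
have B_between : op_between m B M.
  split=> [|x|x]; rewrite -?rE//.
  by rewrite -[B](subrK (op_scalar m)); exact/saD/sa_scalar.
(* [m <= M] can only fail when [H], and hence [K], is the zero space. *)
have [[x x0]|H0] := pselect (exists x : H, x <> 0); last first.
  have Id0 : (1 : bounded_op H) = 0.
    apply: bounded_opP => x; apply: contrapT => x0.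
    by apply: H0; exists x.
  have K0 (y : K) : y = 0.
    by rewrite -[LHS]op1 -Phi_unital Id0 linear0.
  apply/op_psdP; split=> [x y|x]; rewrite (K0 x) linear0.
    by rewrite !rp0l.
  by rewrite rp0l.
have sx : 0 < sq x by rewrite lt_neqAle sq_ge0 andbT; apply/eqP => /esym/sq_eq0.
have [_ mA2 AM2] := A_between.
have mM : m <= M by rewrite -(ler_pM2r sx) (le_trans (mA2 x)).
have t01 : 0 <= t <= 1 by rewrite t_ge0.
have [sT T0] :=
  spectral_geometric_mean_psd Phi_pos Phi_unital t m_gt0 A_between B_between.
have A_pos : op_pos A by exists m, M.
have B_pos : op_pos B by exists m, M.
have sG : sa (op_powR (geometric_mean (op_inv A) B) t).
  exact/op_pos_sa/op_powR_pos/geometric_mean_pos.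
apply/op_leP; split.
  by apply: saB; [exact: saZ|apply/(positive_map_sa Phi_pos)/sa_conj/sG/op_pos_sa].
move=> y; apply: le_trans (positive_map_spectral_geometric_mean
  Phi_pos Phi_unital m_gt0 mM A_between B_between t01 y) _.
rewrite opZ rpZl ler_wpM2r//.
exact: spectral_geometric_mean_constant_le.
Qed.
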